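(* Let $G\in\{SU(2),SO(3)\}$, $N\in\{1,2,\ldots\}$, let $\mathbf{l}\in\mathcal{L}^N$ be ordered with minimal partition $(\mathbf{l}^{(1)},\ldots,\mathbf{l}^{(N_{\rm blocks})})$, and let $L\in\mathcal{L}_G$. Let $M^{\rm up}$ be the block matrix with column blocks $K'\in\mathcal{M}_L$ (columns $\mathbf{m}'\in\overline{\mathcal{M}}_{\mathbf{l},K'}$), row blocks $K\in\{-L,-L+1,\ldots,L-1\}\cup\{L+1\}$ (rows $\mathbf{m}\in\overline{\mathcal{M}}_{\mathbf{l},K}$), and whose only nonzero blocks are, for $K\in\{-L,\ldots,L-1\}$, $$M^{\rm up}_{K,K}[\mathbf{m},\mathbf{m}']=\sqrt{(L+K+1)(L-K)}\,\delta_{\mathbf{m},\mathbf{m}'},$$ $$M^{\rm up}_{K,K+1}[\mathbf{m},\mathbf{m}']=-\lambda_{\mathbf{m}'^{(j)},p+1}\sqrt{(\mathbf{l}^{(j)}_1+p+1)(\mathbf{l}^{(j)}_1-p)}\ \text{ if }\mathbf{m}'=\mathbf{m}_{(j,p,p+1)}\text{ for some }j,p\ (\text{and }0\text{ otherwise}),$$ and $$M^{\rm up}_{L+1,L}[\mathbf{m},\mathbf{m}']=\lambda_{\mathbf{m}'^{(j)},p-1}\sqrt{(\mathbf{l}^{(j)}_1-p+1)(\mathbf{l}^{(j)}_1+p)}\ \text{ if }\mathbf{m}'=\mathbf{m}_{(j,p,p-1)}\text{ for some }j,p\ (\text{and }0\text{ otherwise}).$$ Let $\mathbf{c}_i=\{c_{\mathbf{m},i}\}_{\mathbf{m}\in\overline{\mathcal{M}}_{\mathbf{l},\le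 L}}$, $i=1,\ldots,\dim(\ker(M^{\rm up}))$, be a basis of $\ker(M^{\rm up})$. Then a basis of $\bar V^{\mathbf{l},L}$ is given by $$b_i=\Big[\sum_{\mathbf{m}\in\overline{\mathcal{M}}_{\mathbf{l},K}}c_{\mathbf{m},i}\,\bar\phi^{\mathbf{l}}_{\mathbf{m}}\Big]_{K\in\mathcal{M}_L},\qquad i=1,\ldots,\dim(\ker(M^{\rm up})).$$ In addition, $\dim(\bar V^{\mathbf{l},L})=\dim(\ker(M^{\rm up}))=|\overline{\mathcal{M}}_{\mathbf{l},L}|-|\overline{\mathcal{M}}_{\mathbf{l},L+1}|$.
   Context: Setting. $\mathcal{L}_{SU(2)}=\{0,\frac12,1,\ldots\}$, $\mathcal{L}_{SO(3)}=\{0,1,2,\ldots\}$. For $\ell\in\mathcal{L}_G$, $\mathcal{M}_\ell=\{-\ell,\ldots,\ell\}$ (integer steps) and $D^\ell:G\to\mathbb{C}^{\mathcal{M}_\ell\times\mathcal{M}_\ell}$ is the Wigner-D matrix (irreducible representation of dimension $2\ell+1$ in the standard basis for ZYZ Euler angles), characterized by its derivatives at the identity in the directions of the infinitesimal rotations $X_1=X_3$ about $z$ and $X_2$ about $y$ (these generate the Lie algebra): $dD^\ell(X_1)_{\mu,m}=dD^\ell(X_3)_{\mu,m}=-\mathrm{i}m\,\delta_{\mu m}$, and $dD^\ell(X_2)_{\mu,m}=\frac12\sqrt{(\ell-m+1)(\ell+m)}$ if $m=\mu+1$, $-\frac12\sqrt{(\ell+m+1)(\ell-m)}$ if $m=\mu-1$,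 $0$ otherwise. $\mathcal{L}$ is a totally ordered index set; every $l\in\mathcal{L}$ has a component $\ell\in\mathcal{L}_G$ (e.g. $l=\ell$ or $l=(n,\ell)$), and in arithmetic expressions $l$ stands for its $\ell$-component; $\mathcal{M}_l=\mathcal{M}_\ell$. $G$ acts on a domain $\Omega$ and diagonally on $\Omega^N$. For $l\in\mathcal{L}$, $\phi^l_m:\Omega\to\mathbb{F}$, $m\in\mathcal{M}_l$ ($\mathbb{F}$ a complex vector space in which values can be multiplied commutatively, e.g. $\mathbb{C}$) are orthonormal ($\langle\phi^l_m,\phi^{l'}_{m'}\rangle=\delta_{ll'}\delta_{mm'}$) with $\phi^l_m(Q\cdot r)=\sum_{m'}D^\ell_{m,m'}(Q)\phi^l_{m'}(r)$; products $\prod_i\phi^{l_i}_{m_i}(r_i)$, over all $\mathbf l\in\mathcal L^N$ and $\mathbf m$, are orthonormal for the tensor-product scalar product. For $\mathbf{l}\in\mathcal{L}^N$: $\mathcal{M}_{\mathbf{l}}=\prod_i\mathcal{M}_{l_i}$; $\bar\phi^l_m(r_1,\ldots,r_N)=\sum_{i=1}^N\phi^l_m(r_i)$; $\bar\phi^{\mathbf{l}}_{\mathbf{m}}=\prod_i\bar\phi^{l_i}_{m_i}$; $\bar V^{\mathbf{l}}$ is the complex span of the $\bar\phi^{\mathbf{l}}_{\mathbf{m}}$, $\mathbf{m}\in\mathcal{M}_{\mathbf{l}}$. $\bar V^{\mathbf{l},L}$ is the space of $F\in[\bar V^{\mathbf{l}}]^{2L+1}$ (components indexed by $\mathcal{M}_L$)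 with $F(Q\cdot R)=D^L(Q)F(R)$ for all $Q\in G$, $R\in\Omega^N$. Classes. $\overline{\mathcal{M}}_{\mathbf{l}}$ is the set of classes of $\mathcal{M}_{\mathbf{l}}$ under $\mathbf{m}\sim\pi\mathbf{m}$ for permutations $\pi\in S_N$ with $\pi\mathbf{l}=\mathbf{l}$ (equality of the full indices in $\mathcal{L}$). Both $\bar\phi^{\mathbf{l}}_{\mathbf{m}}$ and $\sum\mathbf{m}=\sum_im_i$ depend only on the class. $\overline{\mathcal{M}}_{\mathbf{l},K}=\{\mathbf{m}\in\overline{\mathcal{M}}_{\mathbf{l}}:\sum\mathbf{m}=K\}$ (possibly empty), $\overline{\mathcal{M}}_{\mathbf{l},\le L}=\bigcup_{K\in\mathcal{M}_L}\overline{\mathcal{M}}_{\mathbf{l},K}$. Minimal partition: ordered $\mathbf{l}$ is a concatenation of blocks $\mathbf{l}^{(1)},\ldots,\mathbf{l}^{(N_{\rm blocks})}$, each a single repeated value, different blocks having different values; $\mathbf{l}^{(j)}_1$ is the value in block $j$, and $\mathbf{m}=(\mathbf{m}^{(1)},\ldots,\mathbf{m}^{(N_{\rm blocks})})$ accordingly. $\lambda_{\mathbf{m}^{(j)},p}$ is the number of occurrences of $p\in\mathcal{M}_{\mathbf{l}^{(j)}_1}$ in $\mathbf{m}^{(j)}$; these counts determine the class. For $p\ne q$ in $\mathcal{M}_{\mathbf{l}^{(j)}_1}$ with $\lambda_{\mathbf{m}^{(j)},p}>0$, $\mathbf{m}_{(j,p,q)}$ is the class obtained from $\mathbf{m}$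 by replacing one $p$ in block $j$ by $q$. *)

(* Defs.v *)
From HB Require Import structures.
From mathcomp Require Import all_boot all_order all_algebra.
From mathcomp Require Import perm spectral complex.
From mathcomp Require Import all_classical all_reals all_analysis.
Set Implicit Arguments. Unset Strict Implicit. Unset Printing Implicit Defensive.
Import Order.TTheory GRing.Theory Num.Theory.
Import numFieldNormedType.Exports.
Local Open Scope ring_scope.
Local Open Scope complex_scope.
Local Open Scope quotient_scope.

Section Groups.
Variable R : realType.

Variant rotation_group := SU2 | SO3.

Definition ambient (G : rotation_group) : nzRingType :=
  match G with SU2 => 'M[R[i]]_2 | SO3 => 'M[R]_3 end.

Definition in_group (G : rotation_group) : ambient G -> bool :=
  match G with
  | SU2 => fun Q : 'M[R[i]]_2 => (Q \is unitarymx) && (\det Q == 1)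
  | SO3 => fun Q : 'M[R]_3 => (Q *m Q^T == 1%:M) && (\det Q == 1)
  end.

Definition mx_of_rows (K : nzRingType) (n : nat) (s : seq (seq K)) : 'M[K]_n :=
  \matrix_(i, j) nth 0 (nth [::] s i) j.

(* The one-parameter subgroups exp(t X_1) = exp(t X_3) (about z) and exp(t X_2)
   (about y); in SU(2) these are exp(-i t sigma_z / 2) and
   exp(-i t sigma_y / 2), which the covering SU(2) -> SO(3) sends to the
   rotations by the angle t. *)
Definition rotZ (G : rotation_group) : R -> ambient G :=
  match G with
  | SU2 => fun t => mx_of_rows 2
      [:: [:: cos (t / 2) -i* sin (t / 2); 0];
          [:: 0; cos (t / 2) +i* sin (t / 2)]]
  | SO3 => fun t => mx_of_rows 3
      [:: [:: cos t; - sin t; 0];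
          [:: sin t; cos t; 0];
          [:: 0; 0; 1]]
  end.

Definition rotY (G : rotation_group) : R -> ambient G :=
  match G with
  | SU2 => fun t => mx_of_rows 2
      [:: [:: (cos (t / 2))%:C; (- sin (t / 2))%:C];
          [:: (sin (t / 2))%:C; (cos (t / 2))%:C]]
  | SO3 => fun t => mx_of_rows 3
      [:: [:: cos t; 0; sin t];
          [:: 0; 1; 0];
          [:: - sin t; 0; cos t]]
  end.

Definition is_action (G : rotation_group) (Omega : Type)
    (act : ambient G -> Omega -> Omega) : Prop :=
  (forall r, act 1 r = r) /\
  (forall Q Q' r, in_group Q -> in_group Q' ->
     act (Q * Q') r = act Q (act Q' r)).

End Groups.

(* An element ell of L_G is encoded by the natural number 2 ell, and m in
   M_ell = {-ell, ..., ell} by the natural number m + ell <= 2 ell. *)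
Definition spin_pred (G : rotation_group) : pred nat :=
  fun d => if G is SO3 then ~~ odd d else true.

Definition spin (G : rotation_group) : Type := {d : nat | spin_pred G d}.

Definition twice (G : rotation_group) (s : spin G) : nat := val s.

Notation Mell s := 'I_((twice s).+1).

Section Weights.
Variable R : realType.

Definition spinr (G : rotation_group) (s : spin G) : R := (twice s)%:R / 2.

Definition weight (G : rotation_group) (s : spin G) (m : Mell s) : R :=
  (m : nat)%:R - spinr s.

(* Entries (mu, m) of dD^s(X_1) = dD^s(X_3) and dD^s(X_2). *)
Definition dDZ (G : rotation_group) (s : spin G) (mu m : Mell s) : R[i] :=
  if mu == m then 0 -i* weight m else 0.

Definition dDY (G : rotation_group) (s : spin G) (mu m : Mell s) : R[i] :=
  (if weight m == weight mu + 1 then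
     2^-1 * Num.sqrt ((spinr s - weight m + 1) * (spinr s + weight m))
   else if weight m == weight mu - 1 then
     - (2^-1 * Num.sqrt ((spinr s + weight m + 1) * (spinr s - weight m)))
   else 0)%:C.

Definition has_cderiv0 (f : R -> R[i]) (d : R[i]) : Prop :=
  is_derive (0 : R) (1 : R) (fun t : R => complex.Re (f t)) (complex.Re d) /\
  is_derive (0 : R) (1 : R) (fun t : R => complex.Im (f t)) (complex.Im d).

(* Since the subgroups rotZ and rotY generate G, these conditions determine
   D s Q for all Q in G. *)
Record is_wignerD (G : rotation_group)
    (D : forall s : spin G, ambient R G -> 'M[R[i]]_((twice s).+1)) : Prop :=
  IsWignerD {
    wignerD1 : forall s, D s 1 = 1%:M;
    wignerDM : forall s Q Q', in_group Q -> in_group Q' ->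
      D s (Q * Q') = D s Q *m D s Q';
    wignerD_dZ : forall s mu m,
      has_cderiv0 (fun t => D s (rotZ G t) mu m) (dDZ mu m);
    wignerD_dY : forall s mu m,
      has_cderiv0 (fun t => D s (rotY G t) mu m) (dDY mu m) }.

End Weights.

Section LinearAlgebra.
Local Open Scope classical_set_scope.

Definition lin_span (K : nzRingType) (U : lmodType K) (I : finType) (b : I -> U)
    : set U :=
  [set u | exists a : I -> K, u = \sum_i a i *: b i].

Definition lin_indep (K : nzRingType) (U : lmodType K) (I : finType)
    (b : I -> U) : Prop :=
  forall a : I -> K, \sum_i a i *: b i = 0 -> forall i, a i = 0.

Definition is_basis (K : nzRingType) (U : lmodType K) (V : set U) (I : finType)
    (b : I -> U) : Prop :=
  V = lin_span b /\ lin_indep b.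

Definition has_dim (K : nzRingType) (U : lmodType K) (V : set U) (n : nat)
    : Prop :=
  exists b : 'I_n -> U, is_basis V b.

Definition scalar_product_on (R : realType) (U : lmodType R[i]) (H : set U)
    (ip : U -> U -> R[i]) : Prop :=
  [/\ H 0,
      forall a u v, H u -> H v -> H (a *: u + v),
      forall a u v w, H u -> H v -> H w ->
        ip (a *: u + v) w = a * ip u w + ip v w,
      forall u v, H u -> H v -> ip v u = (ip u v)^* &
      forall u, H u -> u <> 0 -> 0 < ip u u].

Definition tensor (R : realType) (F : comAlgType R[i]) (Omega : Type) (N : nat)
    (f : 'I_N -> Omega -> F) : ('I_N -> Omega) -> F :=
  fun r => \prod_i f i (r i).

(* On an orthonormal family in H this makes the products of its members
   orthonormal in HN. *)
Definition tensor_scalar_product (R : realType) (F : comAlgType R[i])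
    (Omega : Type) (N : nat)
    (H : set (Omega -> F)) (ip : (Omega -> F) -> (Omega -> F) -> R[i])
    (HN : set (('I_N -> Omega) -> F))
    (ipN : (('I_N -> Omega) -> F) -> (('I_N -> Omega) -> F) -> R[i]) : Prop :=
  scalar_product_on HN ipN /\
  forall f g : 'I_N -> Omega -> F, (forall i, H (f i)) -> (forall i, H (g i)) ->
    [/\ HN (tensor f), HN (tensor g) &
        ipN (tensor f) (tensor g) = \prod_i ip (f i) (g i)].

End LinearAlgebra.

Section OneParticleBasis.
Variables (R : realType) (G : rotation_group) (disp : Order.disp_t).
Variables (LI : orderType disp) (ell : LI -> spin G).
Variables (Omega : Type) (F : comAlgType R[i]).
Variable (phi : forall l : LI, Mell (ell l) -> Omega -> F).
Local Open Scope classical_set_scope.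

Definition phi_equivariant (act : ambient R G -> Omega -> Omega)
    (D : forall s : spin G, ambient R G -> 'M[R[i]]_((twice s).+1)) : Prop :=
  forall (l : LI) (m : Mell (ell l)) Q r, in_group Q ->
    phi m (act Q r) = \sum_m' D (ell l) Q m m' *: phi m' r.

Definition phi_orthonormal (H : set (Omega -> F))
    (ip : (Omega -> F) -> (Omega -> F) -> R[i]) : Prop :=
  (forall l (m : Mell (ell l)), H (phi m)) /\
  (forall l l' (m : Mell (ell l)) (m' : Mell (ell l')),
     ip (phi m) (phi m') = ((l == l') && (m == m' :> nat))%:R).

End OneParticleBasis.

Section Classes.
Variables (G : rotation_group) (disp : Order.disp_t).
Variables (LI : orderType disp) (ell : LI -> spin G).
Variables (N : nat) (l : N.-tuple LI).

Definition Mtuple : finType := {dffun forall i : 'I_N, Mell (ell (tnth l i))}.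

(* m ~ pi m for the permutations pi with pi l = l; as m i and m (pi i) have
   different types, they are compared through their numerical values. *)
Definition mequiv (m m' : Mtuple) : bool :=
  [exists s : 'S_N, [forall i, (tnth l (s i) == tnth l i)
                               && (m' i == m (s i) :> nat)]].

Lemma mequiv_refl : reflexive mequiv.
Proof.
by move=> m; apply/existsP; exists 1%g; apply/forallP => i; rewrite perm1 !eqxx.
Qed.

Lemma mequiv_imp_sym m m' : mequiv m m' -> mequiv m' m.
Proof.
case/existsP => s /forallP hs; apply/existsP; exists s^-1%g; apply/forallP => i.
have /andP[] := hs (s^-1%g i).
pose v (m0 : Mtuple) k : nat := m0 k.
rewrite -/(v m' (s^-1%g i)) -/(v m (s (s^-1%g i))) -/(v m i) permKV.
by rewrite eq_sym => -> /=; rewrite eq_sym.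
Qed.

Lemma mequiv_sym : symmetric mequiv.
Proof. by move=> m m'; apply/idP/idP; apply: mequiv_imp_sym. Qed.

Lemma mequiv_trans : transitive mequiv.
Proof.
move=> m2 m1 m3 /existsP[s /forallP hs] /existsP[t /forallP ht].
apply/existsP; exists (t * s)%g; apply/forallP => i.
have /andP[h1 h2] := hs (t i); have /andP[h3 h4] := ht i.
pose v (m0 : Mtuple) k : nat := m0 k.
rewrite -/(v m3 i) -/(v m1 ((t * s)%g i)) permM (eqP h1) h3 /=.
by rewrite /v (eqP h4) h2.
Qed.

Canonical mequiv_equiv := EquivRel mequiv mequiv_refl mequiv_sym mequiv_trans.

Definition Mclass : Type := {eq_quot mequiv}.

HB.instance Definition _ := Quotient.on Mclass.
HB.instance Definition _ := Finite.copy Mclass (can_type (@reprK _ Mclass)).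

End Classes.

Section Coupling.
Variables (R : realType) (G : rotation_group) (disp : Order.disp_t).
Variables (LI : orderType disp) (ell : LI -> spin G).
Variables (N : nat) (l : N.-tuple LI).

(* The sum of a class, and below its lambda and its product phibar, do not
   depend on the representative. *)
Definition Msum (x : Mclass ell l) : R := \sum_i weight R (repr x i).

Definition MbarK (K : R) : {set Mclass ell l} := [set x | Msum x == K].

Definition Mbar_le (L : spin G) : {set Mclass ell l} :=
  \bigcup_(K : Mell L) MbarK (weight R K).

Definition Mbar_rows (L : spin G) : {set Mclass ell l} :=
  (\bigcup_(K : Mell L | weight R K != spinr R L) MbarK (weight R K))
    :|: MbarK (spinr R L + 1).

(* The j-th block of l consists of n repetitions of v, where (v, n) is the
   j-th item of blocks. *)
Definition minimal_partition (blocks : seq (LI * nat)) : Prop :=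
  [/\ l = flatten [seq nseq b.2 b.1 | b <- blocks] :> seq LI,
      uniq (unzip1 blocks) & all (fun b => (0 < b.2)%N) blocks].

Variable blocks : seq (LI * nat).

Definition in_block (j : 'I_(size blocks)) (i : 'I_N) : bool :=
  reshape_index (unzip2 blocks) i == j.

Definition block_spin (j : 'I_(size blocks)) : spin G :=
  ell (tnth (in_tuple blocks) j).1.

Definition lambda (x : Mclass ell l) (j : 'I_(size blocks))
    (p : Mell (block_spin j)) : nat :=
  #|[set i | in_block j i & repr x i == p :> nat]|.

(* y = x_(j,p,q): some element of y is obtained from an element of x by
   replacing one p in block j by q. *)
Definition replaced (x y : Mclass ell l) (j : 'I_(size blocks))
    (p q : Mell (block_spin j)) : bool :=
  [exists m : Mtuple ell l, exists m' : Mtuple ell l, exists i : 'I_N,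
    [&& \pi_(Mclass ell l) m == x, \pi_(Mclass ell l) m' == y, in_block j i,
        m i == p :> nat, m' i == q :> nat &
        [forall k, (k != i) ==> (m' k == m k)]]].

Definition repl_index : finType :=
  {j : 'I_(size blocks) & (Mell (block_spin j) * Mell (block_spin j))%type}.

(* For x' = x_(j,p,p+1), the factor lambda_{x'^(j),p+1}
   sqrt((l_j + p + 1)(l_j - p)); the triple (j, p, p+1) is unique. *)
Definition up_entry (x x' : Mclass ell l) : R :=
  if [pick t : repl_index | (weight R (tagged t).2 == weight R (tagged t).1 + 1)
        && replaced x x' (tagged t).1 (tagged t).2]
  is Some t then
    let s := spinr R (block_spin (tag t)) in
    let p := weight R (tagged t).1 in
    (lambda x' (tagged t).2)%:R * Num.sqrt ((s + p + 1) * (s - p))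
  else 0.

Definition down_entry (x x' : Mclass ell l) : R :=
  if [pick t : repl_index | (weight R (tagged t).2 == weight R (tagged t).1 - 1)
        && replaced x x' (tagged t).1 (tagged t).2]
  is Some t then
    let s := spinr R (block_spin (tag t)) in
    let p := weight R (tagged t).1 in
    (lambda x' (tagged t).2)%:R * Num.sqrt ((s - p + 1) * (s + p))
  else 0.

Variable L : spin G.

(* The block M_{K,K'} containing the entry is given by the sums K of the row
   class x and K' of the column class x'. *)
Definition Mup_entry (x x' : Mclass ell l) : R :=
  let K := Msum x in
  let K' := Msum x' in
  let Lr := spinr R L in
  if K == Lr + 1 then (if K' == Lr then down_entry x x' else 0)
  else if K' == K then Num.sqrt ((Lr + K + 1) * (Lr - K)) * (x == x')%:R
  else if K' == K + 1 then - up_entry x x'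
  else 0.

Definition Mup : 'M[R[i]]_(#|Mbar_rows L|, #|Mbar_le L|) :=
  \matrix_(a, b) (Mup_entry (enum_val a) (enum_val b))%:C.

Definition kerMup : {vspace 'cV[R[i]]_(#|Mbar_le L|)} :=
  lker (linfun (mulmx Mup : 'cV[R[i]]_(#|Mbar_le L|) -> 'cV_(#|Mbar_rows L|))).

Variables (Omega : Type) (F : comAlgType R[i]).
Variable (phi : forall l : LI, Mell (ell l) -> Omega -> F).

Definition phibar1 (k : LI) (m : Mell (ell k)) : ('I_N -> Omega) -> F :=
  fun r => \sum_i phi m (r i).

Definition phibar (m : Mtuple ell l) : ('I_N -> Omega) -> F :=
  fun r => \prod_i phibar1 (m i) r.

Definition Vbar : set (('I_N -> Omega) -> F) := lin_span phibar.

Definition VbarL (act : ambient R G -> Omega -> Omega)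
    (D : forall s : spin G, ambient R G -> 'M[R[i]]_((twice s).+1))
    : set (Mell L -> ('I_N -> Omega) -> F) :=
  [set f | (forall K, Vbar (f K)) /\
           (forall Q r, in_group Q -> forall K,
              f K (fun i => act Q (r i)) = \sum_K' D L Q K K' *: f K' r)]%classic.

Definition bvec (c : 'cV[R[i]]_(#|Mbar_le L|)) : Mell L -> ('I_N -> Omega) -> F :=
  fun K => \sum_(a < #|Mbar_le L| | enum_val a \in MbarK (weight R K))
             c a ord0 *: phibar (repr (enum_val a)).

End Coupling.

(* Main.v *)
Require Import Defs.
From HB Require Import structures.
From mathcomp Require Import all_boot all_order all_algebra.
From mathcomp Require Import perm spectral complex.
From mathcomp Require Import all_classical all_reals all_analysis.
From mathcomp Require Import ring lra zify.
Set Implicit Arguments. Unset Strict Implicit. Unset Printing Implicit Defensive.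
Import Order.TTheory GRing.Theory Num.Theory.
Import numFieldNormedType.Exports.
Local Open Scope ring_scope.
Local Open Scope complex_scope.

(** A member of VbarL is a family of combinations, indexed by K in M_L, of the
    symmetrized products phibar m, which only depend on the class of m. If the
    coefficients are required to be constant on classes, they are unique
    ([phibar_free]). This is not immediate, because phibar m is a product of sums
    over the particles and, once expanded, contains products of several
    one-particle functions at the same particle, to which orthonormality does not
    apply. But a relation between the phibar m holds at all configurations,
    including those in which particles coincide, and this suffices to isolate the
    terms in which every particle carries one function: a homogeneous form of
    degree N which vanishes at the sums of N elements of a set also has a
    vanishing polarization on that set ([sum_perm_eq0], proved with finite
    differences).

    By uniqueness, a family is equivariant if and only if its coefficients A
    intertwine the tensor product of the representations D^(l_i) with D^L. As the
    group is generated by the rotations about z and y ([group_generated]), and as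
    two one-parameter groups are intertwined as soon as their derivatives at the
    origin are ([one_parameter_intertwine]), this amounts to two linear relations
    ([intertwinesP]). The one for z says that the component K of A is supported
    on the tuples with sum K; the one for y splits by weight into a raising and a
    lowering relation, so that the components of A form a standard basis of an
    irreducible representation of spin L, or vanish ([inf_intertwines_string]).

    The equations of the kernel of Mup are only a part of these relations: each
    component below the top one is obtained by lowering the next one, and the top
    one is killed by raising. The remaining relations follow from the commutation
    relation of the two operators and from positivity ([lowering_string]): with
    respect to the standard scalar product on the functions of tuples, the raising
    and the lowering operator are adjoint, so there is no nonzero highest weight
    vector of negative weight. The translation from tuples to classes
    ([sum_up_entry], [sum_down_entry], [sum_col], [Mup_ker_string]) explains the
    factors lambda: lambda counts the sites at which a tuple can be changed in
    order to reach the other class. Hence c maps to bvec c bijectively from the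
    kernel onto VbarL.

    The rows of Mup are independent ([Mup_row_free]): the diagonal blocks are
    invertible, and the transpose of the last block of rows is a lowering operator
    on vectors of weight L + 1, which is injective, again by positivity. So the
    dimension of the kernel is the number of columns minus the number of rows. *)

(** * Functions of bounded degree *)

Section FiniteDifferences.
Variables (X V : zmodType).

(** Generalized polynomials of degree at most [n]: the functions killed by any
    [n + 1] finite differences. They are closed under the passage to a
    difference, on which all inductions below rest, and their values may lie in
    any abelian group. *)
Fixpoint fdeg (n : nat) (g : X -> V) : Prop :=
  match n with
  | 0 => forall x y, g x = g y
  | n'.+1 => forall h, fdeg n' (fun x => g (x + h) - g x)
  end.

Definition period (g : X -> V) (v : X) := forall x, g (x + v) = g x.

Lemma fdeg_ext n (g g' : X -> V) : g =1 g' -> fdeg n g -> fdeg n g'.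
Proof.
elim: n g g' => [|n IH] g g' e /= hg; first by move=> x y; rewrite -!e.
by move=> h; apply: IH (hg h) => x; rewrite !e.
Qed.

Lemma fdeg0 n : fdeg n (fun=> 0 : V).
Proof.
elim: n => [|n IH] //= h; apply: fdeg_ext IH => x.
by rewrite subrr.
Qed.

Lemma fdegD n (g g' : X -> V) :
  fdeg n g -> fdeg n g' -> fdeg n (fun x => g x + g' x).
Proof.
elim: n g g' => [|n IH] g g' /= hg hg'.
  by move=> x y; rewrite (hg x y) (hg' x y).
move=> h; apply: fdeg_ext (IH _ _ (hg h) (hg' h)) => x.
by rewrite opprD addrACA.
Qed.

Lemma fdeg_sum n (I : Type) (s : seq I) (g : I -> X -> V) :
  (forall i, fdeg n (g i)) -> fdeg n (fun x => \sum_(i <- s) g i x).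
Proof.
move=> hg; elim: s => [|i s IH].
  by apply: fdeg_ext (fdeg0 n) => x; rewrite big_nil.
by apply: fdeg_ext (fdegD (hg i) IH) => x; rewrite big_cons.
Qed.

Lemma fdeg_shift n (g : X -> V) h : fdeg n g -> fdeg n (fun x => g (x + h)).
Proof.
elim: n g h => [|n IH] g h /= hg; first by move=> x y; apply: hg.
by move=> k; apply: fdeg_ext (IH _ h (hg k)) => x; rewrite addrAC.
Qed.

(** Along a period [q v] the values at the points [x + s v], [s < q], are a
    full cycle, so the differences in the direction [v] sum to zero over it;
    these differences have smaller degree and the same period, hence are equal by
    induction. *)
Lemma period_div n (g : X -> V) (q : nat) v :
    (forall u : V, u *+ q = 0 -> u = 0) ->
  fdeg n g -> period g (v *+ q) -> period g v.
Proof.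
move=> tf; elim: n g => [|n IH] g /= hg hp x; first exact: hg.
pose dg x := g (x + v) - g x.
have dgp : period dg v.
  apply: (IH dg (hg v)) => y.
  by rewrite /dg addrAC !hp.
have dgs s : dg (x + v *+ s) = dg x.
  by elim: s => [|s IHs]; rewrite ?mulr0n ?addr0 // mulrSr addrA dgp.
apply/eqP; rewrite -subr_eq0; apply/eqP; apply: tf.
have -> : (g (x + v) - g x) *+ q = \sum_(0 <= s < q) dg (x + v *+ s).
  by rewrite (eq_bigr (fun=> dg x)) // sumr_const_nat subn0.
rewrite (eq_bigr (fun s => g (x + v *+ s.+1) - g (x + v *+ s))); last first.
  by move=> s _; rewrite /dg mulrSr addrA.
by rewrite telescope_sumr // hp mulr0n addr0 subrr.
Qed.

(** The difference of [g] in a direction [w] of [A] has smaller degree and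
    vanishes at the sums of [n - 1] elements of [A], because both [w] and [0]
    belong to [A]. By induction every element of [A] is a period of [g], hence so
    is everything that [A] generates up to division, and [g] is constant. *)
Lemma fdeg_eq0 n (g : X -> V) (A : X -> Prop) :
    (forall (q : nat) (u : V), (0 < q)%N -> u *+ q = 0 -> u = 0) ->
    A 0 ->
    (forall P : X -> Prop, P 0 -> (forall w, A w -> P w) ->
       (forall u v, P u -> P v -> P (u - v)) ->
       (forall q v, (0 < q)%N -> P (v *+ q) -> P v) -> forall x, P x) ->
    fdeg n g ->
    (forall w : 'I_n -> X, (forall i, A (w i)) -> g (\sum_i w i) = 0) ->
  forall x, g x = 0.
Proof.
move=> tf A0 Agen; elim: n g => [|n IH] g hg hA.
  by move=> x; rewrite (hg x (\sum_(i < 0) 0)) hA // => -[].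
have per x : period g x.
  apply: (Agen (period g)) => [y|w Aw y|u v hu hv y|q v q0 hv].
  - by rewrite addr0.
  - apply/eqP; rewrite -subr_eq0; apply/eqP.
    apply: (IH (fun x => g (x + w) - g x) (hg w)) => ws hws.
    have hcons z : A z -> g (\sum_i ws i + z) = 0.
      move=> Az; pose ws' (i : 'I_n.+1) := oapp ws z (unlift ord_max i).
      have -> : \sum_i ws i + z = \sum_i ws' i.
        rewrite big_ord_recr /= /ws' unlift_none /=; congr (_ + _).
        apply: eq_bigr => i _.
        have -> : widen_ord (leqnSn n) i = lift ord_max i.
          by apply: val_inj; rewrite [RHS]lift_max.
        by rewrite liftK.
      by apply: hA => i; rewrite /ws'; case: unliftP => [j|] _ //=.
    by rewrite hcons // -[\sum_i ws i]addr0 hcons // subrr.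
  - by rewrite -(hv (y + (u - v))) -addrA subrK hu.
  - exact: (period_div (tf q ^~ q0) hg hv).
move=> x; have := per x 0; rewrite add0r => ->.
by have := hA (fun=> 0) (fun=> A0); rewrite sumr_const mul0rn.
Qed.

End FiniteDifferences.

Section AffineProducts.
Variables (K : comNzRingType) (X : zmodType) (V : lmodType K).

Lemma fdegZ n (g : X -> V) (c : K) : fdeg n g -> fdeg n (fun x => c *: g x).
Proof.
elim: n g => [|n IH] g /= hg; first by move=> x y; rewrite (hg x y).
by move=> h; apply: fdeg_ext (IH _ (hg h)) => x; rewrite scalerBr.
Qed.

Lemma fdeg_mul_affine n (a : X -> K) (al : X -> K) (g : X -> V) :
    (forall x h, a (x + h) = a x + al h) ->
  fdeg n g -> fdeg n.+1 (fun x => a x *: g x).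
Proof.
move=> ha; elim: n g => [|n IH] g hg h.
  have c z : g z = g 0 by apply: hg.
  by move=> x y; rewrite !ha !c -!scalerBl !(addrC _ (al h)) !addrK.
have := fdegD (IH _ (hg h)) (fdegZ (al h) (fdeg_shift h hg)).
apply: fdeg_ext => x.
by rewrite ha scalerDl scalerBr addrAC.
Qed.

Lemma fdeg_prod_affine (I : Type) (s : seq I) (a al : I -> X -> K) (v : V) :
    (forall i x h, a i (x + h) = a i x + al i h) ->
  fdeg (size s) (fun x => (\prod_(i <- s) a i x) *: v).
Proof.
move=> ha; elim: s => [|i s IH] /=.
  by move=> x y; rewrite !big_nil.
have := fdeg_mul_affine (ha i) IH.
by apply: fdeg_ext => x; rewrite big_cons scalerA.
Qed.

End AffineProducts.

(** * Polarization on the diagonal *)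

Lemma prodr_bool (K : comNzRingType) (I : finType) (b : I -> bool) :
  \prod_i (b i)%:R = [forall i, b i]%:R :> K.
Proof.
case: (boolP [forall i, b i]) => [/forallP h|].
  by rewrite big1 // => i _; rewrite h.
by rewrite negb_forall => /existsP[i /negbTE hi]; rewrite (bigD1 i) //= hi mul0r.
Qed.

Section PolarForm.
Variables (K : numFieldType) (V : lmodType K) (n : nat).
Let N := n.+1.
Variable t : {ffun 'I_N -> 'I_N} -> V.

(* When t f is the value of a kernel at the points selected by f, this is the
   homogeneous form of degree N attached to the kernel, at the combination of
   the points with weights y; integer weights count repetitions. *)
Let P (y : 'I_N -> K) : V := \sum_(f : {ffun 'I_N -> 'I_N}) (\prod_j y (f j)) *: t f.

Let P_scale c y : P (fun i => c * y i) = c ^+ N *: P y.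
Proof.
rewrite /P scaler_sumr; apply: eq_bigr => f _.
by rewrite big_split /= prodr_const card_ord scalerA.
Qed.

Let P_counts (h : {ffun 'I_N -> 'I_N}) :
  P (fun k => \sum_i (h i == k)%:R) = \sum_(f : {ffun 'I_N -> 'I_N}) t [ffun i => h (f i)].
Proof.
rewrite /P (eq_bigr (fun f : {ffun 'I_N -> 'I_N} =>
    \sum_(g : {ffun 'I_N -> 'I_N}) (\prod_j (h (g j) == f j)%:R) *: t f)); last first.
  by move=> f _; rewrite bigA_distr_bigA scaler_suml.
rewrite exchange_big /=; apply: eq_bigr => g _.
rewrite (bigD1 [ffun i => h (g i)]) //= [X in _ + X]big1 ?addr0 => [|f fg].
  by rewrite big1 ?scale1r // => j _; rewrite ffunE eqxx.
rewrite prodr_bool; case: forallP => [e|]; last by rewrite scale0r.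
by case/eqP: fg; apply/ffunP => i; rewrite ffunE (eqP (e i)).
Qed.

(** Inclusion-exclusion: the values at the indicators of the sets that contain
    the image of [f] cancel unless [f] is onto. *)
Let P_polarization :
  \sum_(S : {set 'I_N}) (\prod_i (if i \in S then 1 else -1)) *:
     P (fun i => (i \in S)%:R) = \sum_(f : {ffun 'I_N -> 'I_N} | injectiveb f) t f.
Proof.
under eq_bigr => S _ do rewrite /P scaler_sumr.
rewrite exchange_big /= [RHS]big_mkcond /=; apply: eq_bigr => f _.
under eq_bigr => S _ do rewrite scalerA.
rewrite -scaler_suml; transitivity ((injectiveb f)%:R *: t f); last first.
  by case: ifP => _; rewrite ?scale1r ?scale0r.
congr (_ *: _).
pose u i : K := (i \notin codom f)%:R.
transitivity (\prod_i (1 - u i)).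
  rewrite bigA_distr /=; apply: eq_bigr => S _.
  have -> : \prod_i (if i \in S then 1 else - u i) =
     (\prod_i (if i \in S then 1 else -1)) *
       \prod_i ((i \in S) || (i \notin codom f))%:R.
    rewrite -big_split; apply: eq_bigr => i _ /=.
    by case: ifP => _ /=; rewrite ?mulr1 // mulN1r.
  congr (_ * _); rewrite !prodr_bool; congr (nat_of_bool _)%:R.
  apply/forallP/forallP => h i.
    by case: (boolP (i \in codom f)) => [/codomP[j ->]|]; rewrite ?h ?orbT.
  by have := h (f i); rewrite codom_f orbF.
have -> : \prod_i (1 - u i) = \prod_i (i \in codom f)%:R.
  by apply: eq_bigr => i _; rewrite /u; case: (i \in codom f); rewrite ?subr0 ?subrr.
rewrite prodr_bool; congr (nat_of_bool _)%:R.
apply/forallP/injectiveP => [h | /injF_onto h i]; last exact: h.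
apply/injectiveP; rewrite /injectiveb /dinjectiveb -/(codom f).
apply/card_uniqP; rewrite size_codom card_ord -[RHS](card_ord N).
by apply: eq_card => i; rewrite h.
Qed.

Hypothesis t_vanish :
  forall h : {ffun 'I_N -> 'I_N}, \sum_(f : {ffun 'I_N -> 'I_N}) t [ffun i => h (f i)] = 0.

Let X := {ffun 'I_N -> rat}.

(* The affine parametrization of the points with coordinate sum N; the term
   x = 0 goes to N times the first basis vector, so that a sum of N vectors, each
   zero or a basis vector, goes to the counts of a map of 'I_N to itself. *)
Let coord (i : 'I_N) (x : X) : K :=
  ratr (x i) + (N%:R - \sum_j ratr (x j)) * (i == ord0)%:R.

Let unit (j : 'I_N) : X := [ffun i => (i == j)%:R].

Let P_coord_sums (w : 'I_N -> X) :
  (forall i, w i = 0 \/ exists j, w i = unit j) ->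
  P (fun i => coord i (\sum_k w k)) = 0.
Proof.
move=> hw.
(* A zero summand stands for a further copy of the point number zero. *)
have [h hh] : exists h : {ffun 'I_N -> 'I_N}, forall k i,
    (h k == i)%:R = ratr (w k i) + (1 - \sum_j ratr (w k j)) * (i == ord0)%:R :> K.
  have hk k : exists j : 'I_N, forall i,
    (j == i)%:R = ratr (w k i) + (1 - \sum_j ratr (w k j)) * (i == ord0)%:R :> K.
    case: (hw k) => [->|[j ->]].
      exists ord0 => i; rewrite ffunE rmorph0 add0r big1 ?subr0 ?mul1r 1?eq_sym //.
      by move=> j _; rewrite ffunE rmorph0.
    exists j => i; rewrite ffunE (bigD1 j) //= big1 ?addr0.
      by rewrite ffunE eqxx rmorph1 subrr mul0r addr0 rmorph_nat eq_sym.
    by move=> k' /negbTE hk'; rewrite ffunE hk' rmorph0.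
  have [h hh] := choice hk.
  by exists (finfun h) => k i; rewrite ffunE hh.
rewrite -(t_vanish h) -P_counts; congr P; apply/funext => i.
rewrite [RHS](eq_bigr _ (fun k _ => hh k i)).
rewrite big_split /= /coord sum_ffunE rmorph_sum; congr (_ + _).
rewrite -mulr_suml sumrB sumr_const card_ord exchange_big /=.
congr ((_ - _) * _); apply: eq_bigr => j _.
by rewrite sum_ffunE rmorph_sum.
Qed.

Let coordD i (x h : X) : coord i (x + h) =
  coord i x + (ratr (h i) - (\sum_j ratr (h j)) * (i == ord0)%:R).
Proof.
rewrite /coord ffunE rmorphD.
rewrite (eq_bigr (fun j => ratr (x j) + ratr (h j))); last first.
  by move=> j _; rewrite ffunE rmorphD.
by rewrite big_split /=; ring.
Qed.

Let P_coord x : P (fun i => coord i x) = 0.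
Proof.
apply: (@fdeg_eq0 X V N (fun x => P (fun i => coord i x))
  (fun w => w = 0 \/ exists j, w = unit j)) => //.
- move=> q u q0 /(congr1 (fun v => (q%:R : K)^-1 *: v)).
  by rewrite -(scaler_nat q u) scalerA mulVf ?pnatr_eq0 -?lt0n // scale1r scaler0.
- by left.
- move=> Q Q0 Qunit QB Qdiv {}x.
  have QN u : Q u -> Q (- u) by rewrite -sub0r; apply: QB.
  have QD u v : Q u -> Q v -> Q (u + v).
    by move=> hu hv; rewrite -[v]opprK; apply: QB => //; apply: QN.
  have QM u k : Q u -> Q (u *+ k).
    by move=> hu; elim: k => // k IH; rewrite mulrSr; apply: QD.
  have QZ j a : Q [ffun i => a * unit j i].
    apply: (Qdiv `|denq a|%N); first by rewrite absz_gt0 denq_neq0.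
    have -> : [ffun i => a * unit j i] *+ `|denq a| = unit j *~ numq a.
      apply/ffunP => i; rewrite !ffunMnE !ffunE.
      have -> : (unit j *~ numq a) i = (unit j i) *~ numq a.
        case: (numq a) => k; first by rewrite -!pmulrn ffunMnE.
        by rewrite NegzE !mulrNz -!pmulrn -ffunMnE [LHS]ffunE.
      rewrite pmulrn absz_denq -mulrzr -[RHS]mulrzr numqE ffunE; ring.
    have Qj : Q (unit j) by apply: Qunit; right; exists j.
    by case: (numq a) => k; rewrite ?NegzE ?mulrNz -!pmulrn; [|apply: QN]; apply: QM.
  have -> : x = \sum_j [ffun i => x j * unit j i].
    apply/ffunP => i; rewrite sum_ffunE (bigD1 i) //= big1 ?addr0.
      by rewrite !ffunE eqxx mulr1.
    by move=> j /negbTE ji; rewrite !ffunE eq_sym ji mulr0.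
  by elim/big_ind: _ => // j _; apply: QZ.
- apply: fdeg_sum => f.
  have sN : size (index_enum 'I_N) = N by rewrite -[RHS]card_ord cardE enumT.
  by rewrite -[X in fdeg X]sN; apply: fdeg_prod_affine => j y h; apply: coordD.
Qed.

(** The form [P] has degree [N] and vanishes at the integer points of the simplex
    of nonnegative coordinates with sum [N], hence at the rational points of the
    hyperplane that they span, hence, by homogeneity, at the indicators of the
    nonempty sets. Its polarization, which is the sum over the permutations, is a
    combination of these values. *)
Lemma polar_form_eq0 : \sum_(s : 'S_N) t (finfun s) = 0.
Proof.
have <- : \sum_(f : {ffun 'I_N -> 'I_N} | injectiveb f) t f = \sum_(s : 'S_N) t (finfun s).
  rewrite (reindex (@pval _)) /=; last first.
    pose in_Sn := insubd (1%g : 'S_N).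
    by exists in_Sn => /= f Uf; first apply: val_inj; apply: insubdK.
  rewrite (eq_bigl predT) => [|s]; last exact: (valP s).
  by apply: eq_bigr => s _; congr t; apply/ffunP => i; rewrite ffunE -pvalE.
rewrite -P_polarization big1 // => S _.
suff -> : P (fun i => (i \in S)%:R) = 0 by rewrite scaler0.
have [->|[i0 i0S]] := set_0Vmem S.
  rewrite /P big1 // => f _.
  by rewrite (bigD1 ord0) //= inE mul0r scale0r.
have S0 : (#|S|%:R : K) != 0 by rewrite pnatr_eq0 -lt0n; apply/card_gt0P; exists i0.
pose x : X := [ffun i => (N%:R / #|S|%:R) * (i \in S)%:R].
have sx : \sum_j ratr (x j) = N%:R :> K.
  rewrite -rmorph_sum (eq_bigr (fun j => (N%:R / #|S|%:R) * (j \in S)%:R : rat)).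
    have cS : \sum_j (j \in S)%:R = #|S|%:R :> rat.
      rewrite -sum1_card natr_sum [RHS]big_mkcond /=.
      by apply: eq_bigr => j _; case: ifP.
    by rewrite -mulr_sumr cS divfK ?rmorph_nat // pnatr_eq0 -lt0n; apply/card_gt0P; exists i0.
  by move=> j _; rewrite ffunE.
have -> : (fun i => (i \in S)%:R) = (fun i => #|S|%:R / N%:R * coord i x) :> ('I_N -> K).
  apply/funext => i; rewrite /coord sx subrr mul0r addr0 ffunE.
  rewrite rmorphM fmorph_div !rmorph_nat mulrA [_ / _ * _]mulrA.
  by rewrite divfK ?pnatr_eq0 // divff // mul1r.
by rewrite P_scale P_coord scaler0.
Qed.

End PolarForm.

(** The sum over all ways of distributing [N] arguments among [N] points, with
    repetitions, mixes the wanted values at distinct points with values on the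
    diagonals. The latter drop out once the points are allowed to coincide. *)
Lemma sum_perm_eq0 (K : numFieldType) (V : lmodType K) (N : nat)
    (t : {ffun 'I_N -> 'I_N} -> V) : (0 < N)%N ->
    (forall h : {ffun 'I_N -> 'I_N},
       \sum_(f : {ffun 'I_N -> 'I_N}) t [ffun i => h (f i)] = 0) ->
  \sum_(s : 'S_N) t (finfun s) = 0.
Proof. by case: N t => // n t _; apply: polar_form_eq0. Qed.

(** * Tuples of indices and the symmetrized products *)

Section Tuples.
Variables (G : rotation_group) (disp : Order.disp_t).
Variables (LI : orderType disp) (ell : LI -> spin G).
Variables (N : nat) (l : N.-tuple LI).
Notation M := (Mtuple ell l).

(** Forgetting the bound makes it possible to rewrite the index [i], on which
    the type of [m i] depends. *)
Definition mval (m : M) (i : 'I_N) : nat := m i.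

Lemma mtuple_eqP (m m' : M) : (forall i, mval m i = mval m' i) -> m = m'.
Proof. by move=> h; apply/ffunP => i; apply: val_inj; apply: h. Qed.

Lemma mtuple_lt (m : M) i : (mval m i < (twice (ell (tnth l i))).+1)%N.
Proof. exact: ltn_ord. Qed.

Lemma mtuple_transport (m : M) i j : tnth l i = tnth l j ->
  (mval m i < (twice (ell (tnth l j))).+1)%N.
Proof. by move=> <-; apply: ltn_ord. Qed.

Definition tuple_stab (s : 'S_N) : bool := [forall i, tnth l (s i) == tnth l i].

Definition mperm (s : 'S_N) (m : M) : M := [ffun i => inord (mval m (s i))].

Lemma mpermE s m i : tuple_stab s -> mval (mperm s m) i = mval m (s i).
Proof.
move/forallP/(_ i)/eqP => h; rewrite /mval ffunE inordK //.
exact: mtuple_transport.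
Qed.

Lemma tuple_stabV s : tuple_stab s -> tuple_stab s^-1%g.
Proof.
move=> /forallP h; apply/forallP => i.
by have := h (s^-1%g i); rewrite permKV eq_sym.
Qed.

Lemma mpermK s m : tuple_stab s -> mperm s^-1%g (mperm s m) = m.
Proof.
move=> hs; apply: mtuple_eqP => i; rewrite mpermE ?tuple_stabV // mpermE //.
by rewrite permKV.
Qed.

Lemma mequivP (m m' : M) :
  reflect (exists2 s, tuple_stab s & m' = mperm s m) (mequiv m m').
Proof.
apply: (iffP existsP) => [[s /forallP hs]|[s hs ->]].
  have st : tuple_stab s by apply/forallP => i; have /andP[] := hs i.
  exists s => //; apply: mtuple_eqP => i; rewrite mpermE //.
  by have /andP[_ /eqP] := hs i.
exists s; apply/forallP => i; rewrite (forallP hs i) /=.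
by apply/eqP; apply: mpermE.
Qed.

Definition class_invariant (T : Type) (A : M -> T) : Prop :=
  forall m m', mequiv m m' -> A m = A m'.

Lemma class_invariantP T (A : M -> T) :
  class_invariant A <-> (forall s m, tuple_stab s -> A (mperm s m) = A m).
Proof.
split=> [h s m hs|h m m' /mequivP[s hs ->]]; last by rewrite h.
by apply/esym/h/mequivP; exists s.
Qed.

Definition class_size (m : M) : nat := #|[set m' | mequiv m m']|.

Lemma mequiv_eql (m m' : M) : mequiv m m' -> mequiv m =1 mequiv m'.
Proof.
move=> mm' m2; apply/idP/idP; last exact: mequiv_trans.
by apply: mequiv_trans; rewrite mequiv_sym.
Qed.

Lemma class_size_invariant : class_invariant class_size.
Proof. by move=> m m' mm'; apply: eq_card => m2; rewrite !inE (mequiv_eql mm'). Qed.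

Lemma class_size_neq0 (K : numDomainType) m : (class_size m)%:R != 0 :> K.
Proof.
rewrite pnatr_eq0 -lt0n; apply/card_gt0P; exists m.
by rewrite inE mequiv_refl.
Qed.

Section PhiBar.
Variables (R : realType) (Omega : Type) (F : comAlgType R[i]).
Variable (phi : forall k : LI, Mell (ell k) -> Omega -> F).

Definition phin (k : LI) (a : nat) : Omega -> F := @phi k (inord a).

Lemma phinE (k : LI) (m : Mell (ell k)) : phi m = phin k m.
Proof. by rewrite /phin inord_val. Qed.

Lemma phibarE (m : M) r :
  phibar phi m r = \prod_i \sum_j phin (tnth l i) (mval m i) (r j).
Proof.
rewrite /phibar; apply: eq_bigr => i _; rewrite /phibar1.
by apply: eq_bigr => j _; rewrite phinE.
Qed.

Lemma phibar_class : class_invariant (phibar phi (l := l)).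
Proof.
apply/class_invariantP => s m hs; apply/funext => r; rewrite !phibarE.
rewrite [RHS](reindex_inj (@perm_inj _ s)) /=; apply: eq_bigr => i _.
by rewrite mpermE // (eqP (forallP hs i)).
Qed.

Lemma scalar_product_sum (U : lmodType R[i]) (H : set U) (ip : U -> U -> R[i])
    (I : Type) (s : seq I) (c : I -> R[i]) (u : I -> U) (w : U) :
    scalar_product_on H ip -> (forall i, H (u i)) -> H w ->
  H (\sum_(i <- s) c i *: u i) /\
  ip (\sum_(i <- s) c i *: u i) w = \sum_(i <- s) c i * ip (u i) w.
Proof.
case=> H0 HD ipD _ _ Hu Hw; elim: s => [|i s [IH1 IH2]].
  rewrite !big_nil; split=> //.
  have := ipD 1 0 0 w H0 H0 Hw; rewrite scale1r addr0 mul1r => /eqP.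
  by rewrite -subr_eq0 opprD addrA subrr sub0r oppr_eq0 => /eqP.
by rewrite !big_cons ipD // IH2; split=> //; apply: HD.
Qed.

Variables (H : set (Omega -> F)) (ip : (Omega -> F) -> (Omega -> F) -> R[i]).
Variables (HN : set (('I_N -> Omega) -> F)).
Variable (ipN : (('I_N -> Omega) -> F) -> (('I_N -> Omega) -> F) -> R[i]).
Hypothesis (hortho : phi_orthonormal phi H ip).
Hypothesis (hipN : tensor_scalar_product H ip HN ipN).
Hypothesis (hN : (0 < N)%N).

Let permuted (s : 'S_N) (m : M) : ('I_N -> Omega) -> F :=
  tensor (fun i => phin (tnth l (s i)) (mval m (s i))).

Let permuted_in s m : HN (permuted s m).
Proof.
have [_ h] := hipN.
have hphi i : H (phin (tnth l (s i)) (mval m (s i))) by case: hortho => hH _; apply: hH.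
by have [] := h _ _ hphi hphi.
Qed.

Let ip_permuted s m m0 :
  ipN (permuted s m) (permuted 1 m0) = (tuple_stab s && (m0 == mperm s m))%:R.
Proof.
have [_ h] := hipN; have [hH ho] := hortho.
have [] := h (fun i => phin (tnth l (s i)) (mval m (s i)))
  (fun i => phin (tnth l ((1%g : 'S_N) i)) (mval m0 ((1%g : 'S_N) i))) => [||_ _ ->];
  try by move=> i; apply: hH.
transitivity (\prod_i ((tnth l (s i) == tnth l i) && (mval m (s i) == mval m0 i))%:R : R[i]).
  apply: eq_bigr => i _; rewrite ho !inordK ?ltn_ord //.
  by rewrite perm1.
rewrite prodr_bool; congr (nat_of_bool _)%:R; apply/forallP/andP.
  move=> hs; have st : tuple_stab s by apply/forallP => i; have /andP[] := hs i.
  split=> //; apply/eqP/mtuple_eqP => i; rewrite mpermE //.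
  by have /andP[_ /eqP] := hs i.
by move=> [hs /eqP ->] i; rewrite (forallP hs i) mpermE ?eqxx.
Qed.

(** Expanding the product of sums over particles gives all ways of
    distributing the factors among the particles. The terms in which a particle
    receives several factors involve products of one-particle functions, about
    which nothing is known; but the part in which every particle receives one
    factor vanishes by itself, and orthonormality applies to it. *)
Lemma phibar_free (A : M -> R[i]) : class_invariant A ->
  \sum_m A m *: phibar phi m = 0 -> forall m, A m = 0.
Proof.
move=> symA A0 m0.
pose T (r : 'I_N -> Omega) : F :=
  \sum_m A m *: \prod_j phin (tnth l j) (mval m j) (r j).
(* At the points r o h, with h any map of 'I_N to itself, the relation reads:
   the sum of the values of T over all reselections of these points is zero. *)
have Tperm r : \sum_(s : 'S_N) T (r \o s) = 0.
  rewrite -[RHS](@sum_perm_eq0 _ F N (fun f : {ffun 'I_N -> 'I_N} => T (r \o f)) hN).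
    by apply: eq_bigr => s _; congr T; apply/funext => i /=; rewrite ffunE.
  move=> h; have := congr1 (fun f => f (r \o h)) A0.
  rewrite fct_sumE; move=> e; apply: etrans e; rewrite /T exchange_big /=.
  apply: eq_bigr => m _; rewrite -scaler_sumr; congr (_ *: _).
  rewrite phibarE bigA_distr_bigA /=; apply: eq_bigr => f _.
  by apply: eq_bigr => j _; rewrite ffunE.
have perm0 : \sum_(p : 'S_N * M) A p.2 *: permuted p.1 p.2 = 0.
  apply/funext => r; rewrite -(pair_big xpredT xpredT (fun s m => A m *: permuted s m)) /=.
  rewrite -[RHS](Tperm r) [RHS](reindex (fun s : 'S_N => s^-1%g)) /=; last first.
    by exists (fun s : 'S_N => s^-1%g) => s _; rewrite invgK.
  rewrite fct_sumE; apply: eq_bigr => s _.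
  rewrite fct_sumE; apply: eq_bigr => m _; congr (_ *: _).
  rewrite /permuted /tensor [RHS](reindex_inj (@perm_inj _ s)) /=.
  apply: eq_bigr => j _.
  by rewrite permK.
have [hipN' _] := hipN.
have [_] := scalar_product_sum (index_enum ('S_N * M)%type) (fun p => A p.2)
  hipN' (fun p => permuted_in p.1 p.2) (permuted_in 1 m0).
have ip0 : ipN 0 (permuted 1 m0) = 0.
  have [_] := @scalar_product_sum _ HN ipN nat [::] (fun=> 0) (fun=> permuted 1 m0)
    (permuted 1 m0) hipN' (fun=> permuted_in 1 m0) (permuted_in 1 m0).
  by rewrite !big_nil.
rewrite perm0 ip0 => /esym.
pose b (p : 'S_N * M) := tuple_stab p.1 && (m0 == mperm p.1 p.2).
rewrite (eq_bigr (fun p => A m0 * (b p)%:R)) => [|p _]; last first.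
  rewrite ip_permuted -/(b p); case bp : (b p); rewrite ?mulr0 // !mulr1.
  apply: symA; apply/mequivP; case/andP: bp => hs /eqP ->.
  by exists p.1.
rewrite -mulr_sumr -natr_sum => /eqP; rewrite mulf_eq0 => /orP[/eqP //|].
rewrite pnatr_eq0 (bigD1 ((1%g : 'S_N), m0)) //= /b /=.
have st1 : tuple_stab 1%g by apply/forallP => i; rewrite perm1.
suff -> : mperm 1 m0 = m0 by rewrite st1 eqxx.
by apply: mtuple_eqP => i; rewrite mpermE // perm1.
Qed.

End PhiBar.
End Tuples.

(** * Operators that act on one site at a time *)

Section SiteOperators.
Variables (R : realType) (G : rotation_group) (disp : Order.disp_t).
Variables (LI : orderType disp) (ell : LI -> spin G).
Variables (N : nat) (l : N.-tuple LI).
Notation M := (Mtuple ell l).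
Notation C := (R[i]).
Notation dim_ k := (twice (ell k)).

Definition upd (m : M) (i : 'I_N) (a : nat) : M :=
  [ffun k => if k == i then inord a else m k].

Lemma updE m i a k : (a <= dim_ (tnth l i))%N ->
  mval (upd m i a) k = if k == i then a else mval m k.
Proof.
move=> ha; rewrite /mval ffunE; case: eqP => // ->.
by rewrite inordK.
Qed.

Lemma upd_id m i : upd m i (mval m i) = m.
Proof.
apply: mtuple_eqP => k; rewrite updE; last by rewrite -ltnS mtuple_lt.
by case: eqP => // ->.
Qed.

Lemma upd_upd m i a b : (a <= dim_ (tnth l i))%N -> (b <= dim_ (tnth l i))%N ->
  upd (upd m i b) i a = upd m i a.
Proof.
move=> ha hb; apply: mtuple_eqP => k; rewrite !updE //.
by case: eqP.
Qed.

Lemma upd_swap m i j a b : i != j ->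
  (a <= dim_ (tnth l i))%N -> (b <= dim_ (tnth l j))%N ->
  upd (upd m j b) i a = upd (upd m i a) j b.
Proof.
move=> ij ha hb; apply: mtuple_eqP => k; rewrite !updE //.
case: eqP => [->|//]; by rewrite (negbTE ij).
Qed.

Lemma upd_mperm s m i a : tuple_stab l s -> (a <= dim_ (tnth l i))%N ->
  upd (mperm s m) i a = mperm s (upd m (s i) a).
Proof.
move=> hs ha; apply: mtuple_eqP => k.
rewrite updE // !mpermE // updE ?(eqP (forallP hs i)) //.
by rewrite (inj_eq perm_inj).
Qed.

(** The action of a Lie algebra element on a tensor product, one factor at a
    time, in terms of the coefficients of a vector; [x k] is the matrix of the
    element on the factor of index [k], acting on rows. *)
Definition site_op (x : LI -> nat -> nat -> C) (A : M -> C) (m : M) : C :=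
  \sum_i \sum_(0 <= a < (dim_ (tnth l i)).+1)
     A (upd m i a) * x (tnth l i) a (mval m i).

Lemma eq_site_op x A A' : A =1 A' -> site_op x A =1 site_op x A'.
Proof.
by move=> e m; apply: eq_bigr => i _; apply: eq_bigr => a _; rewrite e.
Qed.

Lemma site_opZ x c A m : site_op x (fun m' => c * A m') m = c * site_op x A m.
Proof.
rewrite /site_op mulr_sumr; apply: eq_bigr => i _; rewrite mulr_sumr.
by apply: eq_bigr => a _; rewrite mulrA.
Qed.

Lemma site_op0 x m : site_op x (fun=> 0) m = 0.
Proof. by rewrite /site_op big1 // => i _; rewrite big1 // => a _; rewrite mul0r. Qed.

Lemma site_op_invariant x A :
  class_invariant A -> class_invariant (site_op x A).
Proof.
move=> /class_invariantP hA; apply/class_invariantP => s m hs.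
rewrite [RHS](reindex_inj (@perm_inj _ s)) /=; apply: eq_bigr => i _.
rewrite (eqP (forallP hs i)); apply: eq_big_nat => a /= ha.
by rewrite mpermE // upd_mperm // hA.
Qed.

Definition comp_op (x y : LI -> nat -> nat -> C) : LI -> nat -> nat -> C :=
  fun k a c => \sum_(0 <= b < (dim_ k).+1) x k a b * y k b c.

(** Operators on different sites commute, so that only products at a single site
    survive in the commutator. *)
Lemma site_op_commutator x y A m :
  site_op y (site_op x A) m - site_op x (site_op y A) m =
  site_op (comp_op x y) A m - site_op (comp_op y x) A m.
Proof.
pose cross x y := \sum_j \sum_(i | i != j)
  \sum_(0 <= b < (dim_ (tnth l j)).+1) \sum_(0 <= a < (dim_ (tnth l i)).+1)
    A (upd (upd m j b) i a) * x (tnth l i) a (mval m i) * y (tnth l j) b (mval m j).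
have split_op x' y' : site_op y' (site_op x' A) m =
    site_op (comp_op x' y') A m + cross x' y'.
  rewrite -big_split; apply: eq_bigr => j _ /=.
  have e b : (0 <= b < (dim_ (tnth l j)).+1)%N ->
      site_op x' A (upd m j b) * y' (tnth l j) b (mval m j) =
      \sum_(0 <= a < (dim_ (tnth l j)).+1)
         A (upd m j a) * (x' (tnth l j) a b * y' (tnth l j) b (mval m j)) +
      \sum_(i | i != j) \sum_(0 <= a < (dim_ (tnth l i)).+1)
         A (upd (upd m j b) i a) * x' (tnth l i) a (mval m i) *
           y' (tnth l j) b (mval m j).
    move=> /= hb; rewrite /site_op (bigD1 j) //= mulrDl !mulr_suml; congr (_ + _).
      apply: eq_big_nat => a /= ha.
      by rewrite upd_upd // updE // eqxx mulrA.
    apply: eq_bigr => i ij; rewrite mulr_suml; apply: eq_big_nat => a /= ha.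
    by rewrite updE // (negbTE ij).
  rewrite (eq_big_nat _ _ e) big_split /=; congr (_ + _).
    rewrite exchange_big_nat /=; apply: eq_bigr => a _.
    by rewrite /comp_op mulr_sumr.
  by rewrite exchange_big.
have crossC : cross x y = cross y x.
  rewrite /cross [RHS](exchange_big_dep xpredT) //=; apply: eq_bigr => j _.
  apply: eq_big => [i|i ij]; first by rewrite eq_sym.
  rewrite exchange_big_nat /=; apply: eq_big_nat => a /= ha.
  apply: eq_big_nat => b /= hb.
  by rewrite upd_swap // mulrAC.
by rewrite !split_op crossC opprD addrACA subrr addr0.
Qed.

Definition agree_off (i : 'I_N) (m m' : M) : bool :=
  [forall k, (k != i) ==> (mval m' k == mval m k)].

Lemma sum_upd (h : M -> C) m i :
  \sum_(0 <= a < (dim_ (tnth l i)).+1) h (upd m i a) =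
  \sum_(m' | agree_off i m m') h m'.
Proof.
rewrite big_mkord (reindex_onto (fun a : 'I_(dim_ (tnth l i)).+1 => upd m i a)
  (fun m' => m' i)) /=.
  apply: eq_bigl => a; apply/esym/andP; split.
    apply/forallP => k; apply/implyP => ki; rewrite updE ?(negbTE ki) //.
    by rewrite -ltnS.
  by rewrite ffunE eqxx inord_val.
move=> m' /forallP h'; apply: mtuple_eqP => k.
have /implyP := h' k; rewrite updE; last by rewrite -ltnS.
by case: eqP => [-> //|_ /(_ isT)/eqP].
Qed.

(** Both sides are the sum of [g] over the pairs of tuples that agree off [i]. *)
Lemma sum_upd_swap (g : M -> M -> C) i :
  \sum_m \sum_(0 <= a < (dim_ (tnth l i)).+1) g (upd m i a) m =
  \sum_m \sum_(0 <= a < (dim_ (tnth l i)).+1) g m (upd m i a).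
Proof.
under eq_bigr => m _ do rewrite (sum_upd (g ^~ m)).
under [RHS]eq_bigr => m _ do rewrite sum_upd.
rewrite [RHS](exchange_big_dep xpredT) //=; apply: eq_bigr => m _.
apply: eq_bigl => m'; apply: eq_forallb => k.
by congr (_ ==> _); apply: eq_sym.
Qed.

Lemma site_op_transpose x A B :
  \sum_m site_op x A m * B m =
  \sum_m A m * site_op (fun k a b => x k b a) B m.
Proof.
under eq_bigr => m _ do rewrite mulr_suml.
under [RHS]eq_bigr => m _ do rewrite mulr_sumr.
rewrite exchange_big [RHS]exchange_big /=; apply: eq_bigr => i _.
under eq_bigr => m _ do rewrite mulr_suml.
under [RHS]eq_bigr => m _ do rewrite mulr_sumr.
pose g m m' := A m * x (tnth l i) (mval m i) (mval m' i) * B m'.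
have := sum_upd_swap g i; rewrite /g => e.
transitivity (\sum_m \sum_(0 <= a < (dim_ (tnth l i)).+1) g (upd m i a) m).
  apply: eq_bigr => m _; apply: eq_big_nat => a /= ha.
  by rewrite /g updE // eqxx.
rewrite /g e; apply: eq_bigr => m _; apply: eq_big_nat => a /= ha.
by rewrite updE // eqxx mulrAC mulrA.
Qed.

(** As [site_op x] is the adjoint of [site_op y], the squared norm of
    [site_op y B] is [- c] times that of [B]; so both vanish. *)
Lemma site_op_positive x y (c : R) B :
    (forall k a b, x k a b = y k b a) -> (forall k a b, conjc (x k a b) = x k a b) ->
    0 < c ->
    (forall m, site_op x (site_op y B) m = - c%:C * B m) ->
  forall m, B m = 0.
Proof.
move=> xy xr c0 hB.
have conj_op A m : conjc (site_op x A m) = site_op x (fun m' => conjc (A m')) m.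
  rewrite /site_op rmorph_sum; apply: eq_bigr => i _.
  by rewrite rmorph_sum; apply: eq_bigr => a _; rewrite rmorphM /= xr.
have e : \sum_m site_op y B m * conjc (site_op y B m) =
    - c%:C * \sum_m B m * conjc (B m).
  rewrite site_op_transpose mulr_sumr; apply: eq_bigr => m _.
  have -> : (fun k a b => y k b a) = x.
    by apply/funext => k; apply/funext => a; apply/funext => b; rewrite xy.
  have cr : conjc (- c%:C) = - c%:C by rewrite rmorphN; congr (- _); apply: conjc_real.
  by rewrite -conj_op hB rmorphM [X in _ * (X * _)]cr mulrCA.
have p0 : 0 <= \sum_m site_op y B m * conjc (site_op y B m).
  by apply: sumr_ge0 => m _; apply: mulcJ_ge0.
have q0 : 0 <= \sum_m B m * conjc (B m).
  by apply: sumr_ge0 => m _; apply: mulcJ_ge0.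
have cC : 0 < c%:C by rewrite -[0]/(0%:C) ltcR.
have : \sum_m B m * conjc (B m) = 0.
  apply/eqP; rewrite eq_le q0 andbT -(pmulr_rle0 _ cC) -oppr_ge0 -mulNr -e.
  exact: p0.
move/psumr_eq0P => h m; have := h (fun m _ => mulcJ_ge0 (B m)) m isT.
by move/eqP; rewrite mulf_eq0 conjc_eq0 orbb => /eqP.
Qed.

End SiteOperators.

(** * The ladder operators *)

Section Ladder.
Variables (R : realType) (G : rotation_group) (disp : Order.disp_t).
Variables (LI : orderType disp) (ell : LI -> spin G).
Variables (N : nat) (l : N.-tuple LI).
Notation M := (Mtuple ell l).
Notation C := (R[i]).
Notation dim_ k := (twice (ell k)).

(** With [d = 2 ell] and [a = m + ell] this is the square root of
    [(ell + m + 1) (ell - m)]. *)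
Definition ladder_coef (d a : nat) : R := Num.sqrt (a.+1%:R * (d - a)%:R).

Definition raise_coef (k : LI) (a b : nat) : C :=
  if b == a.+1 then (ladder_coef (dim_ k) a)%:C else 0.

Definition lower_coef (k : LI) (a b : nat) : C := raise_coef k b a.

Definition raise : (M -> C) -> M -> C := site_op raise_coef.
Definition lower : (M -> C) -> M -> C := site_op lower_coef.

Definition wt (m : M) : R :=
  \sum_i ((mval m i)%:R - (dim_ (tnth l i))%:R / 2).

Definition wt_supp (K : R) (A : M -> C) : Prop := forall m, wt m <> K -> A m = 0.

Lemma ladder_coef_sqr d a : ladder_coef d a ^+ 2 = a.+1%:R * (d - a)%:R.
Proof. by rewrite sqr_sqrtr // mulr_ge0. Qed.

Lemma ladder_coef0 d : ladder_coef d d = 0.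
Proof. by rewrite /ladder_coef subnn mulr0 sqrtr0. Qed.

Lemma ladder_coef_neq0 d a : (a < d)%N -> (ladder_coef d a)%:C != 0.
Proof.
move=> ad; apply/eqP => /complexI /eqP.
by rewrite sqrtr_eq0 leNgt mulr_gt0 // ltr0n // subn_gt0.
Qed.

Lemma wt_invariant : class_invariant wt.
Proof.
apply/class_invariantP => s m hs; rewrite [RHS](reindex_inj (@perm_inj _ s)) /=.
by apply: eq_bigr => i _; rewrite mpermE // (eqP (forallP hs i)).
Qed.

Lemma raise_invariant A : class_invariant A -> class_invariant (raise A).
Proof. exact: site_op_invariant. Qed.

Lemma lower_invariant A : class_invariant A -> class_invariant (lower A).
Proof. exact: site_op_invariant. Qed.

Lemma wt_upd m i a : (a <= dim_ (tnth l i))%N ->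
  wt (upd m i a) = wt m + a%:R - (mval m i)%:R.
Proof.
move=> ha; rewrite /wt (bigD1 i) //= [in RHS](bigD1 i) //= updE // eqxx.
rewrite (eq_bigr (fun k => (mval m k)%:R - (dim_ (tnth l k))%:R / 2)) => [|k ki].
  by ring.
by rewrite updE // (negbTE ki).
Qed.

Lemma wt_supp_raise K A : wt_supp K A -> wt_supp (K + 1) (raise A).
Proof.
move=> hA m hm; apply: big1 => i _; rewrite big_nat_cond big1 // => a.
rewrite andbT /= => ha; rewrite /raise_coef; case: eqP => [e|]; last by rewrite mulr0.
rewrite hA ?mul0r // => /(congr1 (+%R^~ 1)); rewrite wt_upd // e => hw; apply: hm.
by rewrite -hw -natr1; ring.
Qed.

Lemma wt_supp_lower K A : wt_supp K A -> wt_supp (K - 1) (lower A).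
Proof.
move=> hA m hm; apply: big1 => i _; rewrite big_nat_cond big1 // => a.
rewrite andbT /= => ha; rewrite /lower_coef /raise_coef.
case: eqP => [e|]; last by rewrite mulr0.
rewrite hA ?mul0r // => /(congr1 (+%R^~ (-1))); rewrite wt_upd // e => hw; apply: hm.
by rewrite -hw -natr1; ring.
Qed.

Lemma site_op_diag (x : LI -> nat -> nat -> C) (f : LI -> nat -> R)
    (A : M -> C) (m : M) :
    (forall k a c, (a <= dim_ k)%N -> (c <= dim_ k)%N ->
       x k a c = if a == c then (f k c)%:C else 0) ->
  site_op x A m = (\sum_i f (tnth l i) (mval m i))%:C * A m.
Proof.
move=> hx; rewrite rmorph_sum mulr_suml; apply: eq_bigr => i _.
have mi : (mval m i <= dim_ (tnth l i))%N by rewrite -ltnS mtuple_lt.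
rewrite (eq_big_nat _ _ (F2 := fun a => if a == mval m i then
    A m * (f (tnth l i) (mval m i))%:C else 0)).
  by rewrite -big_mkcond big_nat1_eq /= ltnS mi mulrC.
move=> a /= ha; rewrite hx //; case: eqP => [->|]; last by rewrite mulr0.
by rewrite upd_id.
Qed.

Lemma comp_lower_raise k a c : (a <= dim_ k)%N -> (c <= dim_ k)%N ->
  comp_op ell lower_coef raise_coef k a c =
  if a == c then (c%:R * (dim_ k - c).+1%:R)%:C else 0.
Proof.
move=> ha hc; rewrite /comp_op /lower_coef /raise_coef.
case: eqP => [->|ac]; last first.
  rewrite big1 // => b _; case: eqP => [e|]; last by rewrite mul0r.
  by case: eqP => [e'|]; rewrite ?mulr0 //; case: ac; rewrite e e'.
case: c ha hc => [|c] ha hc.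
  by rewrite big1 => [|b _]; [rewrite mulr0n mul0r | rewrite mul0r].
rewrite (eq_bigr (fun b => if b == c then
    (ladder_coef (dim_ k) c ^+ 2)%:C else 0)); last first.
  move=> b _; rewrite eqSS eq_sym; case: eqP => [->|]; rewrite ?mul0r //.
  by rewrite expr2 rmorphM.
rewrite -big_mkcond big_nat1_eq /= ltnS (ltnW hc) ladder_coef_sqr.
by rewrite -subSn // subSS.
Qed.

Lemma comp_raise_lower k a c : (a <= dim_ k)%N -> (c <= dim_ k)%N ->
  comp_op ell raise_coef lower_coef k a c =
  if a == c then (c.+1%:R * (dim_ k - c)%:R)%:C else 0.
Proof.
move=> ha hc; rewrite /comp_op /lower_coef /raise_coef.
case: eqP => [->|ac]; last first.
  rewrite big1 // => b _; case: eqP => [e|]; last by rewrite mul0r.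
  by case: eqP => [e'|]; rewrite ?mulr0 //; case: ac; move: e'; rewrite e => -[].
rewrite (eq_bigr (fun b => if b == c.+1 then
    (ladder_coef (dim_ k) c ^+ 2)%:C else 0)); last first.
  by move=> b _; case: eqP => _; rewrite ?mul0r // expr2 rmorphM.
rewrite -big_mkcond big_nat1_eq /= ltnS ladder_coef_sqr.
by case: (ltnP c (dim_ k)) => // hd; rewrite (eqP hd) mulr0.
Qed.

(** The relation [[e, f] = h] of the Lie algebra, with [h] acting as twice the
    weight. *)
Lemma raise_lower_commutator (A : M -> C) (m : M) :
  raise (lower A) m = lower (raise A) m + (2 * wt m)%:C * A m.
Proof.
apply/eqP; rewrite addrC -subr_eq; apply/eqP; rewrite site_op_commutator.
rewrite (site_op_diag A m comp_lower_raise) (site_op_diag A m comp_raise_lower).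
rewrite -mulrBl -rmorphB -sumrB; congr (_%:C * _).
rewrite /wt mulr_sumr; apply: eq_bigr => i _.
have mi : (mval m i <= dim_ (tnth l i))%N by rewrite -ltnS mtuple_lt.
by rewrite -!natr1 natrB //; field.
Qed.

Lemma raise_coef_real k a b : conjc (raise_coef k a b) = raise_coef k a b.
Proof. by rewrite /raise_coef; case: eqP => _; [apply: conjc_real|apply: conjc0]. Qed.

(** If [raise] kills [B], the commutator turns [raise (lower B)] into [2 K B],
    which contradicts the positivity of the norm unless [B] is zero. *)
Lemma negative_highest_eq0 K B : K < 0 -> wt_supp K B ->
  (forall m, raise B m = 0) -> forall m, B m = 0.
Proof.
move=> K0 hB rB.
apply: (site_op_positive (x := raise_coef) (y := lower_coef) (c := - (2 * K))).
- by [].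
- exact: raise_coef_real.
- by rewrite oppr_gt0 pmulr_rlt0.
- move=> m; rewrite [LHS]raise_lower_commutator [lower _ _](eq_site_op _ rB).
  rewrite site_op0 add0r -rmorphN opprK.
  by case: (pselect (wt m = K)) => [->//|/hB ->]; rewrite !mulr0.
Qed.

Lemma positive_lowest_eq0 K B : 0 < K -> wt_supp K B ->
  (forall m, lower B m = 0) -> forall m, B m = 0.
Proof.
move=> K0 hB rB.
apply: (site_op_positive (x := lower_coef) (y := raise_coef) (c := 2 * K)).
- by [].
- by move=> k a b; apply: raise_coef_real.
- by rewrite pmulr_rgt0.
- move=> m; have := raise_lower_commutator B m.
  rewrite [raise _ _](eq_site_op _ rB) site_op0 => /esym/eqP.
  rewrite addr_eq0 => /eqP; rewrite -mulNr => e; rewrite [LHS]e.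
  by case: (pselect (wt m = K)) => [->//|/hB ->]; rewrite !mulr0.
Qed.

(** Starting from the top of the string, the commutation relation gives the
    action of [raise] one step further down, because the squares of two
    successive coefficients, [(k + 1) (D - k)] and [(k + 2) (D - k - 1)], differ
    by [2 (k + 1) - D], twice the weight of [A (k + 1)]. The image of the bottom
    vector under [lower] would be killed by [raise] while its weight is
    negative. *)
Lemma lowering_string (D : nat) (A : nat -> M -> C) :
    (forall k, (k <= D)%N -> wt_supp (k%:R - D%:R / 2) (A k)) ->
    (forall k m, (k < D)%N -> lower (A k.+1) m = (ladder_coef D k)%:C * A k m) ->
    (forall m, raise (A D) m = 0) ->
  (forall k m, (k < D)%N -> raise (A k) m = (ladder_coef D k)%:C * A k.+1 m) /\
  (forall m, lower (A 0%N) m = 0).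
Proof.
move=> hs hlow htop.
have hraise j : (j <= D)%N -> forall m,
    raise (A (D - j)%N) m = (ladder_coef D (D - j))%:C * A (D - j).+1 m.
  elim: j => [|j IH] hj m; first by rewrite subn0 ladder_coef0 mul0r htop.
  have hk : (D - j.+1 < D)%N by lia.
  have ek : (D - j.+1).+1 = (D - j)%N by lia.
  have IHj := IH (ltnW hj); move: hk ek IHj.
  move: (D - j.+1)%N => k hk ek IHj.
  rewrite -ek in IHj.
  apply: (mulfI (ladder_coef_neq0 hk)).
  rewrite mulrA -rmorphM -expr2 ladder_coef_sqr.
  rewrite -[LHS]site_opZ -[LHS](eq_site_op _ (fun m => hlow k m hk)).
  rewrite [LHS]raise_lower_commutator.
  rewrite [lower _ _](eq_site_op _ IHj) site_opZ -/(lower _).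
  have -> : (ladder_coef D k.+1)%:C * lower (A k.+2) m =
      (k.+2%:R * (D - k.+1)%:R)%:C * A k.+1 m.
    case: (ltnP k.+1 D) => hk1.
      by rewrite hlow // mulrA -rmorphM -expr2 ladder_coef_sqr.
    have -> : k.+1 = D by apply/eqP; rewrite eqn_leq hk hk1.
    by rewrite ladder_coef0 subnn mulr0 !mul0r.
  rewrite -mulrDl -rmorphD.
  case: (pselect (wt m = k.+1%:R - D%:R / 2)) => [->|hw]; last first.
    by rewrite (hs _ hk m hw) !mulr0.
  have hk' := ltnW hk; congr (_%:C * _).
  by rewrite !natrB // -!natr1; field.
split.
  move=> k m hk; have := hraise (D - k)%N (leq_subr _ _) m.
  by have -> : (D - (D - k))%N = k by lia.
apply: (@negative_highest_eq0 (0%:R - D%:R / 2 - 1)).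
- have : 0 <= D%:R / 2 :> R by rewrite divr_ge0.
  by lra.
- by apply: wt_supp_lower; apply: hs.
move=> m; rewrite raise_lower_commutator.
have h0 := hraise D (leqnn D); rewrite subnn in h0.
rewrite [lower _ _](eq_site_op _ h0) site_opZ -/(lower _).
have -> : (ladder_coef D 0)%:C * lower (A 1%N) m = D%:R%:C * A 0%N m.
  case: (posnP D) => [D0|D0]; first by rewrite D0 ladder_coef0 !mul0r.
  by rewrite hlow // mulrA -rmorphM -expr2 ladder_coef_sqr mul1r subn0.
rewrite -mulrDl -rmorphD.
case: (pselect (wt m = 0%:R - D%:R / 2)) => [->|hw]; last first.
  by rewrite (hs _ (leq0n D) m hw) !mulr0.
have -> : D%:R + 2 * (0%:R - D%:R / 2) = 0 :> R by field.
by rewrite mul0r.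
Qed.

End Ladder.

(** * Classes and occurrence counts *)

Section Counting.
Variables (G : rotation_group) (disp : Order.disp_t).
Variables (LI : orderType disp) (ell : LI -> spin G).
Variables (N : nat) (l : N.-tuple LI).
Notation M := (Mtuple ell l).
Notation dim_ k := (twice (ell k)).

Definition occ (m : M) (k : LI) (a : nat) : nat :=
  \sum_i ((tnth l i == k) && (mval m i == a)).

Let labelled (m : M) : N.-tuple (LI * nat)%type :=
  [tuple (tnth l i, mval m i) | i < N].

Let count_labelled m k a : count_mem (k, a) (labelled m) = occ m k a.
Proof.
rewrite -sum1_count big_map big_enum_cond /= big_mkcond /occ.
by apply: eq_bigr => i _; rewrite xpair_eqE; case: (_ && _).
Qed.

(** Equal counts make the sequences of pairs of an index and a value
    permutations of each other, and such a permutation preserves the indices. *)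
Lemma occP (m m' : M) :
  reflect (forall k a, occ m k a = occ m' k a) (mequiv m m').
Proof.
apply: (iffP idP) => [/mequivP[s hs ->] k a|h].
  rewrite /occ (reindex_inj (@perm_inj _ s)) /=; apply: eq_bigr => i _.
  by rewrite mpermE // (eqP (forallP hs i)).
have : perm_eq (labelled m') (labelled m).
  by apply/allP => -[k a] _ /=; rewrite !count_labelled h.
case/tuple_permP => s hs; apply/mequivP.
have hsi i : (tnth l i, mval m' i) = (tnth l (s i), mval m (s i)).
  have := congr1 (fun t => nth (tnth l i, 0%N) t i) hs.
  by rewrite -!tnth_nth !tnth_mktuple.
have st : tuple_stab l s by apply/forallP => i; have [-> _] := hsi i.
exists s => //; apply: mtuple_eqP => i; rewrite mpermE //.
by have [_ ->] := hsi i.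
Qed.

Lemma occ_upd (m : M) i a k b : (a <= dim_ (tnth l i))%N ->
  (occ (upd m i a) k b + ((tnth l i == k) && (mval m i == b)) =
   occ m k b + ((tnth l i == k) && (a == b)))%N.
Proof.
move=> ha; rewrite /occ (bigD1 i) //= [in RHS](bigD1 i) //= updE // eqxx.
rewrite [X in (_ + X + _)%N](eq_bigr (fun k' => (tnth l k' == k) && (mval m k' == b) : nat)).
  by rewrite addnAC [RHS]addnAC; congr (_ + _)%N; apply: addnC.
by move=> k' ki; rewrite updE // (negbTE ki).
Qed.

(** The relation between the counts of [x] and [x'] when [x] arises from [x'] by
    the replacement of one [q] by [p] at the index value [k]; both sides are
    completed by a summand in order to avoid a subtraction. *)
Definition moved (x x' : Mclass ell l) (k : LI) (p q : nat) : Prop :=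
  forall k' b, (occ (repr x) k' b + ((k == k') && (q == b)) =
     occ (repr x') k' b + ((k == k') && (p == b)))%N.

(** The counts of [x] exceed those of [x'] exactly at [(k, p)] and fall short of
    them exactly at [(k, q)]. *)
Lemma moved_inj x x' k p q k2 p2 q2 : p != q ->
  moved x x' k p q -> moved x x' k2 p2 q2 -> [/\ k2 = k, p2 = p & q2 = q].
Proof.
move=> pq h1 h2.
have h z : ((k == z.1) && (p == z.2) + ((k2 == z.1) && (q2 == z.2)) =
   (k == z.1) && (q == z.2) + ((k2 == z.1) && (p2 == z.2)))%N.
  have := h1 z.1 z.2; have := h2 z.1 z.2; lia.
have hp := h (k, p); have hq := h (k, q).
move: hp hq; rewrite /= !eqxx (negbTE pq) [q == p]eq_sym (negbTE pq) /=.
case: (k2 =P k) => //= -> ; case: (p2 =P p) => //= ->.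
by rewrite (negbTE pq) => _; case: (q2 =P q) => //= ->.
Qed.

Lemma occ_repr (m : M) : occ (repr (\pi_(Mclass ell l) m)%qT) =2 occ m.
Proof. by apply/occP; rewrite -[mequiv _ _]/(equiv _ _ _) -eqmodE reprK. Qed.

Lemma pi_mequivP (m m' : M) :
  (\pi_(Mclass ell l) m == \pi_(Mclass ell l) m')%qT = mequiv m m'.
Proof.
apply: (sameP eqP).
exact: (@eqmodP _ (mequiv_equiv ell l) m m').
Qed.

Lemma moved_updP (m : M) i a x : (a <= dim_ (tnth l i))%N ->
  reflect (moved x (\pi_(Mclass ell l) m)%qT (tnth l i) a (mval m i))
    (\pi_(Mclass ell l) (upd m i a) == x)%qT.
Proof.
move=> ha; rewrite -[x in _ == x]reprK pi_mequivP.
apply: (iffP (occP _ _)) => h k b.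
  by rewrite occ_repr -h occ_upd.
by apply/eqP; rewrite -(eqn_add2r ((tnth l i == k) && (mval m i == b))) occ_upd // h occ_repr.
Qed.

Variable blocks : seq (LI * nat).
Hypothesis hblocks : minimal_partition l blocks.

Notation block_val j := (tnth (in_tuple blocks) j).1.

(** Distinct blocks carry distinct values, so [l] shows the block of a position. *)
Lemma in_blockE (j : 'I_(size blocks)) (i : 'I_N) :
  in_block j i = (tnth l i == block_val j).
Proof.
have [hl hu _] := hblocks.
have shp : shape [seq nseq b.2 b.1 | b <- blocks] = unzip2 blocks.
  by rewrite /shape -map_comp; apply: eq_map => b /=; rewrite size_nseq.
have sz : sumn (unzip2 blocks) = N.
  by rewrite -shp -size_flatten -hl size_tuple.
set j' := reshape_index (unzip2 blocks) i.
have hj' : (j' < size blocks)%N.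
  by rewrite -(size_map snd); apply: reshape_indexP; rewrite sz.
have li : tnth l i = block_val (Ordinal hj').
  rewrite (tnth_nth (block_val j)) hl nth_flatten shp -/j'.
  rewrite (nth_map (block_val j, 0%N)) // nth_nseq.
  have -> : (reshape_offset (unzip2 blocks) i <
     (nth (block_val j, 0%N) blocks j').2)%N.
    rewrite -(nth_map _ 0%N snd) //; apply: reshape_offsetP; by rewrite sz.
  by congr (_.1); apply/esym/(tnth_nth _ (in_tuple blocks) (Ordinal hj')).
rewrite /in_block -/j' li !(tnth_nth (tnth l i, 0%N)) /=.
rewrite -!(nth_map (tnth l i, 0%N) (tnth l i) fst) //.
by rewrite nth_uniq // size_map.
Qed.

End Counting.

(** * The entries of the matrix as transition rates *)

Section Entries.
Variables (R : realType) (G : rotation_group) (disp : Order.disp_t).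
Variables (LI : orderType disp) (ell : LI -> spin G).
Variables (N : nat) (l : N.-tuple LI).
Notation M := (Mtuple ell l).
Notation C := (R[i]).
Notation dim_ k := (twice (ell k)).
Notation cls m := (\pi_(Mclass ell l) m)%qT.
Variable blocks : seq (LI * nat).
Hypothesis hblocks : minimal_partition l blocks.
Notation block_val j := (tnth (in_tuple blocks) j).1.

Lemma replaced_moved (x x' : Mclass ell l) (j : 'I_(size blocks))
    (p q : Mell (block_spin ell j)) :
  replaced x x' p q -> moved x x' (block_val j) p q.
Proof.
case/existsP => m /existsP[m' /existsP[i /and5P[/eqP <- /eqP <-]]].
rewrite (in_blockE hblocks) => /eqP lij /eqP mi /andP[/eqP m'i /forallP hm].
have pi : (p <= dim_ (tnth l i))%N by rewrite lij -ltnS.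
have -> : m = upd m' i p.
  apply: mtuple_eqP => k; rewrite updE //; case: (k =P i) => [->|/eqP ki].
    exact: mi.
  by have /implyP/(_ ki)/eqP := hm k; rewrite /mval => ->.
have -> : (q : nat) = mval m' i by rewrite /mval m'i.
by rewrite -lij; apply/moved_updP.
Qed.

Lemma upd_replaced (m : M) i (j : 'I_(size blocks)) (p q : Mell (block_spin ell j)) :
  tnth l i = block_val j -> mval m i = q ->
  replaced (cls (upd m i p)) (cls m) p q.
Proof.
move=> lij mi.
have pi : (p <= dim_ (tnth l i))%N by rewrite lij -ltnS.
apply/existsP; exists (upd m i p); apply/existsP; exists m; apply/existsP; exists i.
have ib : in_block j i by rewrite (in_blockE hblocks) lij.
rewrite !eqxx ib /=; apply/and3P; split.
- by rewrite -[nat_of_ord _]/(mval _ i) updE // eqxx.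
- by rewrite -mi.
- apply/forallP => k; apply/implyP => ki.
  have := updE m k pi; rewrite (negbTE ki) => e.
  by apply/eqP/esym/val_inj; exact: e.
Qed.

Variables (cond : nat -> nat -> bool) (w : nat -> nat -> R).
Hypothesis cond_neq : forall p q, cond p q -> p != q.

(** The common form of [up_entry] and [down_entry]. *)
Definition move_entry (x x' : Mclass ell l) : R :=
  if [pick t : repl_index ell blocks |
        cond (tagged t).1 (tagged t).2 && replaced x x' (tagged t).1 (tagged t).2]
  is Some t then
    (lambda x' (tagged t).2)%:R * w (twice (block_spin ell (tag t))) (tagged t).1
  else 0.

(** Fix a tuple [m] in the column class. All changes of [m] at a single site that
    lead to [x] perform the same replacement of [q] by [p] in the same block,
    and there is one of them for each occurrence of [q] in this block: this is
    the factor [lambda]. *)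
Lemma move_entryE (x : Mclass ell l) (m : M) :
  \sum_i \sum_(0 <= a < (dim_ (tnth l i)).+1)
     (cls (upd m i a) == x)%:R *
       (if cond a (mval m i) then w (dim_ (tnth l i)) a else 0) =
  move_entry x (cls m).
Proof.
rewrite /move_entry; case: pickP => [[j [p q]] /= /andP[hc hr]|hnone].
  have hmv := replaced_moved hr.
  have hterm i a : (0 <= a < (dim_ (tnth l i)).+1)%N ->
     (cls (upd m i a) == x)%:R *
       (if cond a (mval m i) then w (dim_ (tnth l i)) a else 0) =
     if a == p then ((tnth l i == block_val j) && (mval m i == q))%:R *
        w (twice (block_spin ell j)) p else 0.
    move=> /= ha; case hca : (cond a (mval m i)); last first.
      rewrite mulr0; case: (a =P p) => [ap|//].
      case: (mval m i =P q) => [mq|]; last by rewrite andbF mul0r.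
      by rewrite ap mq hc in hca.
    case: moved_updP => // [hmv'|hmv'].
      have [-> -> ->] := moved_inj (cond_neq hc) hmv hmv'.
      by rewrite !eqxx mul1r.
    rewrite mul0r; case: (a =P p) => // ap.
    case: (tnth l i =P block_val j) => [lij|]; last by rewrite mul0r.
    case: (mval m i =P q) => [mq|]; last by rewrite mul0r.
    by case: hmv'; rewrite ap lij mq.
  have -> : lambda (cls m) q = occ m (block_val j) q.
    rewrite -occ_repr /lambda /occ -sum1_card big_mkcond /=.
    by apply: eq_bigr => i _; rewrite inE (in_blockE hblocks); case: (_ && _).
  rewrite /occ natr_sum mulr_suml; apply: eq_bigr => i _.
  rewrite (eq_big_nat _ _ (hterm i)) -big_mkcond big_nat1_eq /=.
  case: ltnP => //; case: eqP => [->|_]; last by rewrite mul0r.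
  by move=> hlt; have := ltn_ord p; rewrite ltnNge -ltnS ltnS hlt.
rewrite big1 // => i _; rewrite big_nat_cond big1 // => a; rewrite andbT /= => ha.
case: eqP => [e|]; last by rewrite mul0r.
case hca : (cond a (mval m i)); last by rewrite mulr0.
(* A change leading to x would be found by the search for j, p and q. *)
have [j hj] : exists j : 'I_(size blocks), tnth l i = block_val j.
  have [hl _ _] := hblocks.
  have : tnth l i \in (l : seq LI) by apply: mem_tnth.
  rewrite hl => /flattenP[_ /mapP[b hb ->]]; rewrite mem_nseq => /andP[_ /eqP lb].
  have hi : (index b blocks < size blocks)%N by rewrite index_mem.
  exists (Ordinal hi); rewrite lb; congr (_.1).
  by rewrite (tnth_nth b) /= nth_index.
have ha' : (a < (dim_ (block_val j)).+1)%N by rewrite -hj.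
have hq : (mval m i < (dim_ (block_val j)).+1)%N by rewrite -hj; apply: mtuple_lt.
pose t : repl_index ell blocks := Tagged
  (fun j => (Mell (block_spin ell j) * Mell (block_spin ell j))%type)
  (Ordinal ha' : Mell (block_spin ell j), Ordinal hq : Mell (block_spin ell j)).
have /negbT/negP[] := hnone t.
apply/andP; split; first exact: hca.
have hr := @upd_replaced m i j (Ordinal ha') (Ordinal hq) hj erefl.
by rewrite -e; exact: hr.
Qed.

Lemma sum_move_entry (y : Mclass ell l -> C) (m : M) :
  \sum_x y x * (move_entry x (cls m))%:C =
  site_op (fun k a b => if cond a b then (w (dim_ k) a)%:C else 0)
    (fun m' => y (cls m')) m.
Proof.
under eq_bigr => x _ do rewrite -move_entryE rmorph_sum mulr_sumr.
rewrite exchange_big /=; apply: eq_bigr => i _.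
under eq_bigr => x _ do rewrite rmorph_sum mulr_sumr.
rewrite exchange_big /=; apply: eq_bigr => a _.
rewrite (bigD1 (cls (upd m i a))) //= big1 ?addr0 => [|x /negbTE hx].
  by rewrite eqxx mul1r; case: ifP => _.
by rewrite eq_sym hx mul0r rmorph0 mulr0.
Qed.

End Entries.

Section UpDown.
Variables (R : realType) (G : rotation_group) (disp : Order.disp_t).
Variables (LI : orderType disp) (ell : LI -> spin G).
Variables (N : nat) (l : N.-tuple LI).
Notation M := (Mtuple ell l).
Notation C := (R[i]).
Notation cls m := (\pi_(Mclass ell l) m)%qT.
Variable blocks : seq (LI * nat).
Hypothesis hblocks : minimal_partition l blocks.

Lemma up_entryE (x x' : Mclass ell l) : up_entry R blocks x x' =
  move_entry blocks (fun p q => q == p.+1) (ladder_coef R) x x'.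
Proof.
rewrite /up_entry /move_entry.
set P1 := (fun t : repl_index ell blocks => _ && _).
set P2 := (fun t : repl_index ell blocks => _ && _).
have -> : pick P1 = pick P2.
  apply: eq_pick => t; rewrite /P1 /P2 /weight; congr (_ && _).
  by rewrite addrAC (inj_eq (addIr _)) natr1 eqr_nat.
case: pick => // -[j [p q]] /=; congr (_ * Num.sqrt _).
rewrite /weight /spinr natrB; last by rewrite -ltnS.
by rewrite -natr1; field.
Qed.

Lemma down_entryE (x x' : Mclass ell l) : down_entry R blocks x x' =
  move_entry blocks (fun p q => p == q.+1) (fun d p => ladder_coef R d p.-1) x x'.
Proof.
rewrite /down_entry /move_entry.
set P1 := (fun t : repl_index ell blocks => _ && _).
set P2 := (fun t : repl_index ell blocks => _ && _).
have eP : P1 =1 P2.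
  move=> t; rewrite /P1 /P2 /weight; congr (_ && _).
  by rewrite addrAC (inj_eq (addIr _)) eq_sym subr_eq natr1 eqr_nat.
rewrite (eq_pick eP); case: pickP => // -[j [p q]] /= /andP[/eqP hp _].
congr (_ * Num.sqrt _); rewrite /weight /spinr.
have := ltn_ord p; move: (nat_of_ord p) hp => p' -> /= hq.
rewrite natrB; last by rewrite ltnW.
by rewrite -!natr1; field.
Qed.

Lemma sum_up_entry (y : Mclass ell l -> C) (m : M) :
  \sum_x y x * (up_entry R blocks x (cls m))%:C = raise (fun m' => y (cls m')) m.
Proof.
under eq_bigr => x _ do rewrite up_entryE.
rewrite sum_move_entry // => p q /eqP ->; by rewrite neq_ltn ltnSn.
Qed.

Lemma sum_down_entry (y : Mclass ell l -> C) (m : M) :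
  \sum_x y x * (down_entry R blocks x (cls m))%:C = lower (fun m' => y (cls m')) m.
Proof.
under eq_bigr => x _ do rewrite down_entryE.
rewrite sum_move_entry //; last by move=> p q /eqP ->; rewrite neq_ltn ltnSn orbT.
apply: eq_bigr => i _; apply: eq_bigr => a _; congr (_ * _).
by rewrite /lower_coef /raise_coef; case: eqP => // ->.
Qed.

End UpDown.

(** * One-parameter groups of complex matrices *)

Section ComplexDerivatives.
Variable R : realType.
Notation C := (R[i]).
Implicit Types (f g : R -> C) (t : R) (d e : C).

(** The extension of [has_cderiv0] to an arbitrary base point. *)
Definition has_cderiv t f d : Prop :=
  is_derive t (1 : R) (fun s => complex.Re (f s)) (complex.Re d) /\
  is_derive t (1 : R) (fun s => complex.Im (f s)) (complex.Im d).

Lemma has_cderiv_cst t d : has_cderiv t (fun=> d) 0.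
Proof. by split; apply: is_derive_cst. Qed.

Lemma ReM (x y : C) : complex.Re (x * y) =
  complex.Re x * complex.Re y - complex.Im x * complex.Im y.
Proof. by case: x y => [a b] [c d]. Qed.

Lemma ImM (x y : C) : complex.Im (x * y) =
  complex.Re x * complex.Im y + complex.Im x * complex.Re y.
Proof. by case: x y => [a b] [c d]. Qed.

Lemma ReD (x y : C) : complex.Re (x + y) = complex.Re x + complex.Re y.
Proof. by case: x y => [a b] [c d]. Qed.

Lemma ImD (x y : C) : complex.Im (x + y) = complex.Im x + complex.Im y.
Proof. by case: x y => [a b] [c d]. Qed.

Lemma has_cderivD t f g d e :
  has_cderiv t f d -> has_cderiv t g e -> has_cderiv t (fun s => f s + g s) (d + e).
Proof.
move=> [fr fi] [gr gi]; split.
  have := is_deriveD fr gr; rewrite ReD.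
  by congr (is_derive _ _ _ _); apply/funext => s; rewrite ReD.
have := is_deriveD fi gi; rewrite ImD.
by congr (is_derive _ _ _ _); apply/funext => s; rewrite ImD.
Qed.

Lemma has_cderivM t f g d e :
  has_cderiv t f d -> has_cderiv t g e ->
  has_cderiv t (fun s => f s * g s) (d * g t + f t * e).
Proof.
move=> [fr fi] [gr gi]; split.
  have := is_deriveB (is_deriveM fr gr) (is_deriveM fi gi).
  have -> : (fun s => complex.Re (f s * g s)) =
    (fun s => complex.Re (f s)) * (fun s => complex.Re (g s)) -
    (fun s => complex.Im (f s)) * (fun s => complex.Im (g s)).
    by apply/funext => s; rewrite ReM.
  move/is_derive_eq; apply; rewrite ReD !ReM /GRing.scale /=; ring.
have := is_deriveD (is_deriveM fr gi) (is_deriveM fi gr).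
have -> : (fun s => complex.Im (f s * g s)) =
  (fun s => complex.Re (f s)) * (fun s => complex.Im (g s)) +
  (fun s => complex.Im (f s)) * (fun s => complex.Re (g s)).
  by apply/funext => s; rewrite ImM.
move/is_derive_eq; apply; rewrite ImD !ImM /GRing.scale /=; ring.
Qed.

Lemma has_cderiv_eq t f d e : has_cderiv t f d -> d = e -> has_cderiv t f e.
Proof. by move=> h <-. Qed.

Lemma has_cderiv_unique t f d e : has_cderiv t f d -> has_cderiv t f e -> d = e.
Proof.
move=> [hr hi] [hr' hi']; apply/eqP; rewrite eq_complex; apply/andP; split; apply/eqP.
  by rewrite -(@derive_val _ _ _ _ _ _ _ hr) -(@derive_val _ _ _ _ _ _ _ hr').
by rewrite -(@derive_val _ _ _ _ _ _ _ hi) -(@derive_val _ _ _ _ _ _ _ hi').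
Qed.

Lemma has_cderiv_sum t (I : Type) (r : seq I) (f : I -> R -> C) (d : I -> C) :
  (forall i, has_cderiv t (f i) (d i)) ->
  has_cderiv t (fun s => \sum_(i <- r) f i s) (\sum_(i <- r) d i).
Proof.
move=> h; elim: r => [|i r IH].
  rewrite big_nil; have := has_cderiv_cst t 0; congr (has_cderiv _ _ _).
  by apply/funext => s; rewrite big_nil.
rewrite big_cons; have := has_cderivD (h i) IH; congr (has_cderiv _ _ _).
by apply/funext => s; rewrite big_cons.
Qed.

Lemma has_cderiv_prod t (I : eqType) (r : seq I) (f : I -> R -> C) (d : I -> C) :
  uniq r -> (forall i, has_cderiv t (f i) (d i)) ->
  has_cderiv t (fun s => \prod_(i <- r) f i s)
    (\sum_(i <- r) d i * \prod_(k <- r | k != i) f k t).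
Proof.
move=> ur h; elim: r ur => [_|i r IH /= /andP[ir ur]].
  rewrite big_nil; have := has_cderiv_cst t 1; congr (has_cderiv _ _ _).
  by apply/funext => s; rewrite big_nil.
have := has_cderivM (h i) (IH ur).
have -> : (fun s => f i s * \prod_(j <- r) f j s) = (fun s => \prod_(j <- i :: r) f j s).
  by apply/funext => s; rewrite big_cons.
move/has_cderiv_eq; apply; rewrite big_cons; congr (_ + _).
  rewrite big_cons eqxx /=; congr (_ * _); rewrite big_seq [RHS]big_seq_cond.
  apply: eq_bigl => k; case kr : (k \in r) => //=.
  by apply/esym; apply: contraNneq ir => <-.
rewrite mulr_sumr; apply: eq_big_seq => k kr.
rewrite [in RHS]big_cons.
have -> : i != k by apply: contraNneq ir => ->.
by rewrite mulrCA.
Qed.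

Lemma has_cderiv_shift t f d :
  has_cderiv 0 (fun s => f (s + t)) d -> has_cderiv t f d.
Proof.
have sh (u : R -> R) a : is_derive (0 : R) (1 : R) (fun s => u (s + t)) a ->
    is_derive t (1 : R) u a.
  move=> hu.
  have ht : is_derive t (1 : R) (fun s : R => s - t) 1.
    by have := is_deriveB (is_derive_id t (1 : R)) (is_derive_cst t t (1 : R)); rewrite subr0.
  have hu' : is_derive (t - t) (1 : R) (fun s => u (s + t)) a by rewrite subrr.
  have := @is_derive1_comp _ _ (fun s => s - t) _ _ _ hu' ht; rewrite mulr1.
  by congr (is_derive _ _ _ _); apply/funext => s /=; rewrite subrK.
by move=> [hr hi]; split; apply: sh.
Qed.

Lemma has_cderivN_arg f d : has_cderiv 0 f d -> has_cderiv 0 (fun s => f (- s)) (- d).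
Proof.
have opp (u : R -> R) a : is_derive (0 : R) (1 : R) u a ->
    is_derive (0 : R) (1 : R) (fun s => u (- s)) (- a).
  move=> hu.
  have hn : is_derive (0 : R) (1 : R) (fun s : R => - s) (- 1).
    exact: (is_deriveN (is_derive_id (0 : R) (1 : R))).
  have hu' : is_derive (- 0 : R) (1 : R) u a by rewrite oppr0.
  by have := @is_derive1_comp _ _ (fun s => - s) _ _ _ hu' hn; rewrite mulrN1.
by case: d => [a b] [hr hi]; split; apply: opp.
Qed.

Lemma has_cderiv0_cst f : (forall t, has_cderiv t f 0) -> forall t, f t = f 0.
Proof.
move=> h t; apply/eqP; rewrite eq_complex; apply/andP; split; apply/eqP.
  by apply: (is_derive_0_is_cst (f := fun s => complex.Re (f s))) => s; case: (h s).
by apply: (is_derive_0_is_cst (f := fun s => complex.Im (f s))) => s; case: (h s).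
Qed.

Definition mx_cderiv m n t (B : R -> 'M[C]_(m, n)) (dB : 'M[C]_(m, n)) : Prop :=
  forall i j, has_cderiv t (fun s => B s i j) (dB i j).

Lemma mx_cderiv_cst m n t (B : 'M[C]_(m, n)) : mx_cderiv t (fun=> B) 0.
Proof. by move=> i j; rewrite mxE; apply: has_cderiv_cst. Qed.

Lemma mx_cderivM m n p t (B : R -> 'M[C]_(m, n)) (B' : R -> 'M[C]_(n, p)) dB dB' :
  mx_cderiv t B dB -> mx_cderiv t B' dB' ->
  mx_cderiv t (fun s => B s *m B' s) (dB *m B' t + B t *m dB').
Proof.
move=> h h' i j.
have := has_cderiv_sum (index_enum 'I_n) (fun k => has_cderivM (h i k) (h' k j)).
have -> : (fun s => \sum_k B s i k * B' s k j) = (fun s => (B s *m B' s) i j).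
  by apply/funext => s; rewrite mxE.
by move/has_cderiv_eq; apply; rewrite !mxE big_split.
Qed.

(** The derivative of [Y (- t) A X t] vanishes at the origin, hence everywhere by
    translation; so this product is constant, and equal to [A]. *)
Lemma one_parameter_intertwine m n (A : 'M[C]_(m, n))
    (X : R -> 'M[C]_n) (Y : R -> 'M[C]_m) dX dY :
    X 0 = 1%:M -> (forall s t, X (s + t) = X s *m X t) -> mx_cderiv 0 X dX ->
    Y 0 = 1%:M -> (forall s t, Y (s + t) = Y s *m Y t) -> mx_cderiv 0 Y dY ->
    A *m dX = dY *m A ->
  forall t, A *m X t = Y t *m A.
Proof.
move=> X0 XD hX Y0 YD hY hA t.
pose g s := Y (- s) *m A *m X s.
have hYN : mx_cderiv 0 (fun s => Y (- s)) (- dY).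
  by move=> i j; rewrite mxE; exact: (has_cderivN_arg (hY i j)).
have h0 : mx_cderiv 0 (fun s => Y (- s) *m A *m X s) 0.
  have := mx_cderivM (mx_cderivM hYN (mx_cderiv_cst 0 A)) hX.
  by rewrite oppr0 Y0 X0 mulmx0 addr0 mulmx1 mul1mx hA mulNmx addNr.
have gc s : mx_cderiv s g 0.
  move=> i j; apply: has_cderiv_shift.
  have := mx_cderivM (mx_cderivM (mx_cderiv_cst 0 (Y (- s))) h0)
    (mx_cderiv_cst 0 (X s)).
  rewrite mul0mx mulmx0 add0r mul0mx mulmx0 addr0 => /(_ i j).
  congr (has_cderiv _ _ _); apply/funext => u; congr (_ _ i j).
  rewrite /g opprD (addrC (- u)) !YD XD !mulmxA.
  by rewrite -!mulmxA.
have gt : g t = A.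
  have : g t = g 0.
    apply/matrixP => i j; apply: (has_cderiv0_cst (f := fun s => g s i j)) => s.
    by have := gc s i j; rewrite mxE.
  by rewrite /g oppr0 X0 Y0 mul1mx mulmx1.
rewrite -[in RHS]gt /g !mulmxA -YD subrr Y0 mul1mx //.
Qed.

End ComplexDerivatives.

(** * Generation by the rotations about two axes *)

Section Generation.
Variable R : realType.
Notation C := (R[i]).

Lemma rows3E (K : nzRingType) (A : 'M[K]_3) :
  A = mx_of_rows 3 [:: [:: A 0 0; A 0 1; A 0 2%:R];
                       [:: A 1 0; A 1 1; A 1 2%:R];
                       [:: A 2%:R 0; A 2%:R 1; A 2%:R 2%:R]].
Proof.
apply/matrixP => -[[|[|[|//]]] hi] -[[|[|[|//]]] hj]; rewrite !mxE /=;
  by congr (A _ _); apply: val_inj.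
Qed.

Lemma rows2E (K : nzRingType) (A : 'M[K]_2) :
  A = mx_of_rows 2 [:: [:: A 0 0; A 0 1]; [:: A 1 0; A 1 1]].
Proof.
apply/matrixP => -[[|[|//]] hi] -[[|[|//]] hj]; rewrite !mxE /=;
  by congr (A _ _); apply: val_inj.
Qed.

Lemma mul_rows3 (K : comNzRingType) (a b c d e f g h k a' b' c' d' e' f' g' h' k' : K) :
  mx_of_rows 3 [:: [:: a; b; c]; [:: d; e; f]; [:: g; h; k]] *m
  mx_of_rows 3 [:: [:: a'; b'; c']; [:: d'; e'; f']; [:: g'; h'; k']] =
  mx_of_rows 3
    [:: [:: a * a' + b * d' + c * g'; a * b' + b * e' + c * h'; a * c' + b * f' + c * k'];
        [:: d * a' + e * d' + f * g'; d * b' + e * e' + f * h'; d * c' + e * f' + f * k'];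
        [:: g * a' + h * d' + k * g'; g * b' + h * e' + k * h'; g * c' + h * f' + k * k']].
Proof.
apply/matrixP => -[[|[|[|//]]] hi] -[[|[|[|//]]] hj];
  by rewrite !mxE !big_ord_recl big_ord0 !mxE /= addr0 addrA.
Qed.

Lemma mul_rows2 (K : comNzRingType) (a b c d a' b' c' d' : K) :
  mx_of_rows 2 [:: [:: a; b]; [:: c; d]] *m
  mx_of_rows 2 [:: [:: a'; b']; [:: c'; d']] =
  mx_of_rows 2 [:: [:: a * a' + b * c'; a * b' + b * d'];
                   [:: c * a' + d * c'; c * b' + d * d']].
Proof.
apply/matrixP => -[[|[|//]] hi] -[[|[|//]] hj];
  by rewrite !mxE !big_ord_recl big_ord0 !mxE /= addr0.
Qed.

Lemma det_rows2 (K : comNzRingType) (a b c d : K) :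
  \det (mx_of_rows 2 [:: [:: a; b]; [:: c; d]]) = a * d - b * c.
Proof.
rewrite (expand_det_row _ ord0) !big_ord_recl big_ord0 addr0 !mxE /=.
by rewrite /cofactor !det_mx11 !mxE /= expr0 mul1r expr1 mulN1r mulrN.
Qed.

Lemma det_rows3 (K : comNzRingType) (a b c d e f g h k : K) :
  \det (mx_of_rows 3 [:: [:: a; b; c]; [:: d; e; f]; [:: g; h; k]]) =
  a * (e * k - f * h) - b * (d * k - f * g) + c * (d * h - e * g).
Proof.
rewrite (expand_det_row _ ord0) !big_ord_recl big_ord0 !mxE /= /cofactor.
have d2 (x y z w : K) (M : 'M[K]_2) : M 0 0 = x -> M 0 1 = y -> M 1 0 = z -> M 1 1 = w ->
    \det M = x * w - y * z.
  by move=> <- <- <- <-; rewrite {1}(rows2E M) det_rows2.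
rewrite (@d2 e f h k) ?mxE //= (@d2 d f g k) ?mxE //= (@d2 d e g h) ?mxE //=.
by rewrite expr0 expr1 expr2; ring.
Qed.

Lemma tr_rows3 (K : nzRingType) (a b c d e f g h k : K) :
  (mx_of_rows 3 [:: [:: a; b; c]; [:: d; e; f]; [:: g; h; k]])^T =
  mx_of_rows 3 [:: [:: a; d; g]; [:: b; e; h]; [:: c; f; k]].
Proof. by apply/matrixP => -[[|[|[|//]]] hi] -[[|[|[|//]]] hj]; rewrite !mxE. Qed.

Lemma one_rows3 (K : nzRingType) :
  1%:M = mx_of_rows 3 [:: [:: 1; 0; 0]; [:: 0; 1; 0]; [:: 0; 0; 1 : K]].
Proof. by apply/matrixP => -[[|[|[|//]]] hi] -[[|[|[|//]]] hj]; rewrite !mxE. Qed.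

Lemma one_rows2 (K : nzRingType) :
  1%:M = mx_of_rows 2 [:: [:: 1; 0]; [:: 0; 1 : K]].
Proof. by apply/matrixP => -[[|[|//]] hi] -[[|[|//]] hj]; rewrite !mxE. Qed.

Lemma ctr_rows2 (a b c d : C) :
  ((mx_of_rows 2 [:: [:: a; b]; [:: c; d]])^t*)%sesqui =
  mx_of_rows 2 [:: [:: conjc a; conjc c]; [:: conjc b; conjc d]].
Proof. by apply/matrixP => -[[|[|//]] hi] -[[|[|//]] hj]; rewrite !mxE. Qed.

Lemma rows3_inj (K : nzRingType) (a b c d e f g h k a' b' c' d' e' f' g' h' k' : K) :
  mx_of_rows 3 [:: [:: a; b; c]; [:: d; e; f]; [:: g; h; k]] =
  mx_of_rows 3 [:: [:: a'; b'; c']; [:: d'; e'; f']; [:: g'; h'; k']] ->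
  [/\ [/\ a = a', b = b' & c = c'], [/\ d = d', e = e' & f = f'] &
      [/\ g = g', h = h' & k = k']].
Proof.
move/matrixP => E.
have e0 := E 0; have e1 := E 1; have e2 := E 2%:R.
move: (e0 0) (e0 1) (e0 2%:R) (e1 0) (e1 1) (e1 2%:R) (e2 0) (e2 1) (e2 2%:R).
by rewrite !mxE.
Qed.

Lemma rows2_inj (K : nzRingType) (a b c d a' b' c' d' : K) :
  mx_of_rows 2 [:: [:: a; b]; [:: c; d]] = mx_of_rows 2 [:: [:: a'; b']; [:: c'; d']] ->
  [/\ a = a', b = b', c = c' & d = d'].
Proof.
move/matrixP => E; move: (E 0 0) (E 0 1) (E 1 0) (E 1 1).
by rewrite !mxE.
Qed.

Lemma polar (x y : R) : exists r t, [/\ 0 <= r, r ^+ 2 = x ^+ 2 + y ^+ 2,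
  x = r * cos t & y = r * sin t].
Proof.
pose r := Num.sqrt (x ^+ 2 + y ^+ 2).
have r2 : r ^+ 2 = x ^+ 2 + y ^+ 2 by rewrite sqr_sqrtr // addr_ge0 // sqr_ge0.
have r0 : 0 <= r by apply: sqrtr_ge0.
exists r; case: (eqVneq r 0) => [re|rn].
  exists 0; move: r2; rewrite re expr0n /= => /esym/eqP.
  rewrite paddr_eq0 ?sqr_ge0 // !sqrf_eq0 => /andP[/eqP -> /eqP ->].
  by rewrite !mul0r !expr0n addr0.
have rgt : 0 < r by rewrite lt_neqAle eq_sym rn.
pose u := x / r; pose v := y / r.
have uv : u ^+ 2 + v ^+ 2 = 1.
  by rewrite !expr_div_n -mulrDl -r2 divff // expf_neq0.
have hu : -1 <= u <= 1 by apply/andP; split; nra.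
have su : Num.sqrt (1 - u ^+ 2) = `|v| by rewrite -uv addrAC subrr add0r sqrtr_sqr.
have cu : cos (acos u) = u by rewrite acosK // in_itv.
have su' : sin (acos u) = `|v| by rewrite sin_acos.
have xu : x = r * u by rewrite mulrC divfK.
have yv : y = r * v by rewrite mulrC divfK.
case: (lerP 0 v) => hv.
  by exists (acos u); rewrite cu su' ger0_norm.
by exists (- acos u); rewrite cosN sinN cu su' ltr0_norm // opprK.
Qed.

Lemma unit_circle (x y : R) : x ^+ 2 + y ^+ 2 = 1 -> exists t, x = cos t /\ y = sin t.
Proof.
move=> h; have [r [t [r0 r2 -> ->]]] := polar x y.
have -> : r = 1 by apply/eqP; rewrite -sqrp_eq1 // r2 h.
by exists t; rewrite !mul1r.
Qed.

Lemma rotZD G (s t : R) : rotZ G (s + t) = rotZ G s * rotZ G t.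
Proof.
case: G => /=; rewrite -mulmxE ?mul_rows2 ?mul_rows3.
  rewrite mulrDl cosD sinD !mul0r !mulr0 !addr0 !add0r.
  by congr (mx_of_rows 2 [:: [:: _; _]; [:: _; _]]); apply/eqP;
    rewrite eq_complex /=; apply/andP; split; apply/eqP; ring.
rewrite cosD sinD; congr (mx_of_rows 3 [:: [:: _; _; _]; [:: _; _; _]; [:: _; _; _]]); ring.
Qed.

Lemma rotYD G (s t : R) : rotY G (s + t) = rotY G s * rotY G t.
Proof.
case: G => /=; rewrite -mulmxE ?mul_rows2 ?mul_rows3.
  rewrite mulrDl cosD sinD.
  by congr (mx_of_rows 2 [:: [:: _; _]; [:: _; _]]); apply/eqP;
    rewrite eq_complex /=; apply/andP; split; apply/eqP; ring.
rewrite cosD sinD; congr (mx_of_rows 3 [:: [:: _; _; _]; [:: _; _; _]; [:: _; _; _]]); ring.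
Qed.

Lemma rotZ0 G : rotZ G (0 : R) = 1.
Proof.
case: G => /=; rewrite -[RHS]/(1%:M) ?one_rows2 ?one_rows3 ?mul0r cos0 sin0 ?oppr0 //.
Qed.

Lemma rotY0 G : rotY G (0 : R) = 1.
Proof.
case: G => /=; rewrite -[RHS]/(1%:M) ?one_rows2 ?one_rows3 ?mul0r cos0 sin0 ?oppr0 //.
Qed.

Lemma in_group_rotZ G (t : R) : in_group (rotZ G t).
Proof.
case: G => /=.
  have := cos2Dsin2 (t / 2); move: (cos _) (sin _) => c s h.
  apply/andP; split.
    apply/unitarymxP; rewrite ctr_rows2 mul_rows2 one_rows2.
    by congr (mx_of_rows 2 [:: [:: _; _]; [:: _; _]]); apply/eqP;
      rewrite eq_complex /=; apply/andP; split; apply/eqP; lra.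
  rewrite det_rows2; rewrite eq_complex /=; apply/andP.
  by split; apply/eqP; lra.
have := cos2Dsin2 t; move: (cos _) (sin _) => c s h.
apply/andP; split; apply/eqP.
  rewrite tr_rows3 mul_rows3 one_rows3.
  by congr (mx_of_rows 3 [:: [:: _; _; _]; [:: _; _; _]; [:: _; _; _]]); lra.
by rewrite det_rows3; lra.
Qed.

Lemma in_group_rotY G (t : R) : in_group (rotY G t).
Proof.
case: G => /=.
  have := cos2Dsin2 (t / 2); move: (cos _) (sin _) => c s h.
  apply/andP; split.
    apply/unitarymxP; rewrite ctr_rows2 mul_rows2 one_rows2.
    by congr (mx_of_rows 2 [:: [:: _; _]; [:: _; _]]); apply/eqP;
      rewrite eq_complex /=; apply/andP; split; apply/eqP; lra.
  rewrite det_rows2; rewrite eq_complex /=; apply/andP.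
  by split; apply/eqP; lra.
have := cos2Dsin2 t; move: (cos _) (sin _) => c s h.
apply/andP; split; apply/eqP.
  rewrite tr_rows3 mul_rows3 one_rows3.
  by congr (mx_of_rows 3 [:: [:: _; _; _]; [:: _; _; _]; [:: _; _; _]]); lra.
by rewrite det_rows3; lra.
Qed.

Lemma in_groupM G (Q Q' : ambient R G) :
  in_group Q -> in_group Q' -> in_group (Q * Q').
Proof.
case: G Q Q' => /= Q Q' /andP[hQ /eqP dQ] /andP[hQ' /eqP dQ']; rewrite -mulmxE.
  by rewrite (mul_unitarymx hQ hQ') det_mulmx dQ dQ' mulr1 eqxx.
rewrite trmx_mul mulmxA -[Q *m _ *m _]mulmxA (eqP hQ') mulmx1 hQ /=.
by rewrite det_mulmx dQ dQ' mulr1.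
Qed.

Lemma rotation_fixing_z (Q : 'M[R]_3) : Q *m Q^T = 1%:M -> \det Q = 1 ->
  Q 0 2%:R = 0 -> Q 1 2%:R = 0 -> Q 2%:R 2%:R = 1 -> exists c, Q = rotZ SO3 c.
Proof.
rewrite (rows3E Q); move: (Q 0 0) (Q 0 1) (Q 0 2%:R) (Q 1 0) (Q 1 1) (Q 1 2%:R)
  (Q 2%:R 0) (Q 2%:R 1) (Q 2%:R 2%:R) => {Q} p q x s t y u v z.
rewrite tr_rows3 mul_rows3 one_rows3 det_rows3.
move=> /rows3_inj[[h1 h2 _] [_ h3 _] [_ _ h4]] hd.
rewrite !mxE /= => hx hy hz; subst x y z.
have uv : u ^+ 2 + v ^+ 2 = 0 by lra.
have u0 : u = 0 by nra.
have v0 : v = 0 by nra.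
subst u v.
have pt : t = p.
  transitivity (t * (p * p + q * q + 0 * 0)); first by rewrite h1 mulr1.
  transitivity (p * (p * t - q * s) + q * (p * s + q * t)); first by ring.
  have -> : p * t - q * s = 1 by rewrite -hd; ring.
  have -> : p * s + q * t = 0 by rewrite -h2; ring.
  by ring.
have qs : q = - s.
  apply/eqP; rewrite -addr_eq0; apply/eqP.
  transitivity (q + s * (p * p + q * q + 0 * 0)); first by rewrite h1 mulr1.
  transitivity (q + p * (p * s + q * t) - q * (p * t - q * s)); first by ring.
  have -> : p * t - q * s = 1 by rewrite -hd; ring.
  have -> : p * s + q * t = 0 by rewrite -h2; ring.
  by ring.
have [c [pc sc]] : exists c, p = cos c /\ s = sin c.
  by apply: unit_circle; rewrite -h1 qs; ring.
by exists c; rewrite /= pt qs pc sc.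
Qed.

(** The decomposition into Euler angles. An element of [SU2] is determined by its
    first column [(al, ga)], and the angles are read off the polar forms of [al]
    and [ga]. For [SO3], rotate the image of the axis [z] back to [z]; what is
    left is a rotation about [z]. *)
Lemma group_generated G (P : ambient R G -> Prop) :
    (forall t, P (rotZ G t)) -> (forall t, P (rotY G t)) ->
    (forall Q Q', in_group Q -> in_group Q' -> P Q -> P Q' -> P (Q * Q')) ->
  forall Q, in_group Q -> P Q.
Proof.
move=> hZ hY hM Q hQ.
have euler a b c : P (rotZ G a * (rotY G b * rotZ G c)).
  have gY := in_group_rotY G b; have gZ := in_group_rotZ G c.
  exact: hM (in_group_rotZ G a) (in_groupM gY gZ) (hZ a) (hM _ _ gY gZ (hY b) (hZ c)).
suff [a [b [c ->]]] : exists a b c, Q = rotZ G a * (rotY G b * rotZ G c).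
  exact: euler.
case: G Q hQ {P hZ hY hM euler} => /= Q /andP[hQ /eqP dQ].
  move: hQ dQ; rewrite (rows2E Q).
  move: (Q 0 0) (Q 0 1) (Q 1 0) (Q 1 1) => {Q} al be ga de.
  move=> /unitarymxP; rewrite ctr_rows2 mul_rows2 one_rows2 det_rows2.
  move=> /rows2_inj[h1 h2 h3 h4] hd.
  have hde : de = conjc al.
    have h3' : conjc al * ga = - (conjc be * de).
      by apply/eqP; rewrite -addr_eq0 mulrC [conjc be * _]mulrC h3.
    rewrite -[LHS]mulr1 -h1 -[RHS]mulr1 -hd.
    transitivity (conjc al * (al * de) - be * (conjc al * ga)); last by ring.
    by rewrite h3'; ring.
  have hbe : be = - conjc ga.
    have h2' : conjc ga * al = - (conjc de * be).
      by apply/eqP; rewrite -addr_eq0 mulrC [conjc de * _]mulrC h2.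
    rewrite -[LHS]mulr1 -h4 -[RHS]mulr1 -hd.
    transitivity (conjc ga * (be * ga) - de * (conjc ga * al)); last by ring.
    by rewrite h2'; ring.
  have hbe' : conjc be = - ga by rewrite hbe rmorphN; congr (- _); apply: conjcK.
  move: h1; rewrite hbe' hbe mulrNN => h1.
  rewrite hde {h2 h3 h4 hd hde hbe' hbe be de}.
  case: al h1 => [a1 a2]; case: ga => [g1 g2] h1.
  have [r [u [r0 r2 hr1 hr2]]] := polar a1 a2.
  have [s [v [s0 s2 hs1 hs2]]] := polar g1 g2.
  have rs : r ^+ 2 + s ^+ 2 = 1.
    by move: h1 => [<- _]; rewrite r2 s2; ring.
  have [b [hb1 hb2]] := unit_circle rs.
  (* Here al has modulus cos b and argument u, and ga modulus sin b and
     argument v; they are the entries of the product of the three rotations with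
     - u = (a + c) / 2 and v = (a - c) / 2. *)
  exists (v - u), (2 * b), (- u - v).
  have e1 : (v - u) / 2 + (- u - v) / 2 = - u by field.
  have e2 : (v - u) / 2 - (- u - v) / 2 = v by field.
  have e3 : 2 * b / 2 = b by field.
  rewrite -!mulmxE !mul_rows2 e3 -hb1 -hb2.
  have cu := cosN u; have su := sinN u; rewrite -e1 cosD sinD in cu su.
  have cv : cos ((v - u) / 2 - (- u - v) / 2) = cos v by rewrite e2.
  have sv : sin ((v - u) / 2 - (- u - v) / 2) = sin v by rewrite e2.
  rewrite cosD sinD cosN sinN in cv sv.
  rewrite hr1 hr2 hs1 hs2 -cu -[sin u]opprK -su -cv -sv.
  by congr (mx_of_rows 2 [:: [:: _; _]; [:: _; _]]); apply/eqP;
    rewrite eq_complex /=; apply/andP; split; apply/eqP; ring.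
have QtQ : Q^T *m Q = 1%:M by apply: mulmx1C; apply/eqP.
have hxyz : Q 0 2%:R ^+ 2 + Q 1 2%:R ^+ 2 + Q 2%:R 2%:R ^+ 2 = 1.
  move: QtQ; rewrite {1 2}(rows3E Q) tr_rows3 mul_rows3 one_rows3.
  by case/rows3_inj => _ _ [_ _ h]; lra.
have [r [a [r0 r2 hx hy]]] := polar (Q 0 2%:R) (Q 1 2%:R).
have zr : Q 2%:R 2%:R ^+ 2 + r ^+ 2 = 1 by rewrite r2 addrC.
have [b [hz hr]] := unit_circle zr.
pose Q' : ambient R SO3 := rotY SO3 (- b) * (rotZ SO3 (- a) * Q).
have hQ'g : in_group Q'.
  by apply: in_groupM (in_group_rotY SO3 _) (in_groupM (in_group_rotZ SO3 _) _);
    apply/andP; split => //; apply/eqP.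
have Qe : Q = rotZ SO3 a * (rotY SO3 b * Q').
  rewrite /Q' [rotY SO3 b * _]mulrA -rotYD subrr rotY0 mul1r mulrA -rotZD subrr.
  by rewrite rotZ0 mul1r.
suff [c Q'c] : exists c, Q' = rotZ SO3 c by exists a, b, c; rewrite {1}Qe Q'c.
move/andP: hQ'g => [/eqP hQ1 /eqP dQ1]; apply: rotation_fixing_z hQ1 dQ1 _ _ _;
  rewrite /Q' -!mulmxE (rows3E Q) !mul_rows3 mxE /= !(cosN, sinN) ?hx ?hy ?hz ?hr.
- transitivity (sin b * cos b * (cos a ^+ 2 + sin a ^+ 2) - sin b * cos b); first by ring.
  by rewrite cos2Dsin2; ring.
- by ring.
- transitivity (sin b ^+ 2 * (cos a ^+ 2 + sin a ^+ 2) + cos b ^+ 2); first by ring.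
  by rewrite cos2Dsin2 mulr1 addrC cos2Dsin2.
Qed.

End Generation.

(** * The tensor product representation *)

Section TensorRepresentation.
Variables (R : realType) (G : rotation_group) (disp : Order.disp_t).
Variables (LI : orderType disp) (ell : LI -> spin G).
Variables (N : nat) (l : N.-tuple LI).
Notation M := (Mtuple ell l).
Notation C := (R[i]).
Notation dim_ k := (twice (ell k)).

Lemma sum_enum_mtuple (g : M -> C) :
  \sum_(a < #|{: M}|) g (enum_val a) = \sum_m g m.
Proof.
rewrite [RHS](reindex (enum_val : 'I_#|{: M}| -> M)) //=.
by exists enum_rank => m _; rewrite ?enum_valK ?enum_rankK.
Qed.

(** Distributivity over sums whose ranges depend on the factor; the proof
    embeds all ranges into a common one. *)
Lemma prod_sum_mtuple (S : comNzRingType) (g : 'I_N -> nat -> S) :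
  \prod_i \sum_(0 <= a < (dim_ (tnth l i)).+1) g i a =
  \sum_(m : M) \prod_i g i (mval m i).
Proof.
pose B := (\max_i dim_ (tnth l i))%N.
have hB i : (dim_ (tnth l i) <= B)%N by apply: leq_bigmax.
pose Q (i : 'I_N) : pred 'I_B.+1 := fun a => (a <= dim_ (tnth l i))%N.
transitivity (\prod_i \sum_(a : 'I_B.+1 | Q i a) g i a).
  apply: eq_bigr => i _; rewrite (big_nat_widen _ _ B.+1) ?ltnS //.
  by rewrite big_mkord; apply: eq_bigl => a; rewrite ltnS.
rewrite bigA_distr_big_dep.
rewrite (reindex_onto (fun m : M => [ffun i => inord (mval m i) : 'I_B.+1])
  (fun f : {ffun 'I_N -> 'I_B.+1} => [ffun i => inord (f i)] : M)); last first.
  move=> f /familyP hf; apply/ffunP => i; rewrite !ffunE; apply: val_inj.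
  have := hf i; rewrite unfold_in /= => fi.
  by rewrite inordK /mval ffunE inordK // ltnS (leq_trans fi).
have mB (m : M) i : (mval m i < B.+1)%N.
  by rewrite ltnS (leq_trans _ (hB i)) // -ltnS mtuple_lt.
rewrite (eq_bigl predT) => [|m].
  apply: eq_bigr => m _; apply: eq_bigr => i _.
  by rewrite ffunE inordK.
apply/andP; split.
  by apply/familyP => i; rewrite unfold_in /Q ffunE inordK // -ltnS mtuple_lt.
apply/eqP/mtuple_eqP => i; rewrite {1}/mval !ffunE !inordK ?mtuple_lt //.
Qed.

Variable D : forall s : spin G, ambient R G -> 'M[C]_((twice s).+1).
Hypothesis hD : is_wignerD D.

Definition Dnat (Q : ambient R G) (k : LI) (a b : nat) : C :=
  D (ell k) Q (inord a) (inord b).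

Definition rho (Q : ambient R G) (m m' : M) : C :=
  \prod_i Dnat Q (tnth l i) (mval m i) (mval m' i).

Definition rho_mx (Q : ambient R G) : 'M[C]_#|{: M}| :=
  \matrix_(a, b) rho Q (enum_val a) (enum_val b).

Lemma rhoM Q Q' : in_group Q -> in_group Q' ->
  rho_mx (Q * Q') = rho_mx Q *m rho_mx Q'.
Proof.
move=> hQ hQ'; apply/matrixP => a b; rewrite !mxE.
under [RHS]eq_bigr => c _ do rewrite !mxE.
rewrite (sum_enum_mtuple (fun c => rho Q (enum_val a) c * rho Q' c (enum_val b))).
rewrite /rho.
transitivity (\prod_i \sum_(0 <= c < (dim_ (tnth l i)).+1)
  Dnat Q (tnth l i) (mval (enum_val a) i) c *
  Dnat Q' (tnth l i) c (mval (enum_val b) i)).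
  apply: eq_bigr => i _; rewrite /Dnat (wignerDM hD) // mxE big_mkord.
  by apply: eq_bigr => c _; rewrite inord_val.
rewrite prod_sum_mtuple; apply: eq_bigr => m _.
by rewrite -big_split.
Qed.

Lemma rho1E (m m' : M) :
  \prod_i (if mval m i == mval m' i then 1 else 0 : C) = (m == m')%:R.
Proof.
transitivity (\prod_i ((mval m i == mval m' i) : bool)%:R : C).
  by apply: eq_bigr => i _; case: eqP.
rewrite prodr_bool; congr (nat_of_bool _)%:R; apply/forallP/eqP => [h|-> //].
by apply: mtuple_eqP => i; apply/eqP/h.
Qed.

Lemma Dnat1 (k : LI) a b : (a <= dim_ k)%N -> (b <= dim_ k)%N ->
  Dnat 1 k a b = if a == b then 1 else 0.
Proof.
move=> ha hb; rewrite /Dnat (wignerD1 hD) mxE -(inj_eq val_inj) /= !inordK //.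
by case: eqP.
Qed.

Lemma rho1 : rho_mx 1 = 1%:M.
Proof.
apply/matrixP => a b; rewrite !mxE -(inj_eq enum_val_inj) -rho1E.
by apply: eq_bigr => i _; rewrite Dnat1 // -ltnS mtuple_lt.
Qed.

Lemma rho_invariant Q (A : M -> C) : class_invariant A ->
  class_invariant (fun m' => \sum_m A m * rho Q m m').
Proof.
move=> /class_invariantP hA; apply/class_invariantP => s m' hs.
rewrite (reindex (mperm s)) /=; last first.
  exists (mperm s^-1%g) => m _; first exact: mpermK.
  by have := @mpermK _ _ _ ell _ l s^-1%g m (tuple_stabV hs); rewrite invgK.
apply: eq_bigr => m _; rewrite hA //; congr (_ * _).
rewrite /rho [RHS](reindex_inj (@perm_inj _ s)) /=; apply: eq_bigr => i _.
by rewrite !mpermE // (eqP (forallP hs i)).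
Qed.

(** By the product rule, the derivative is a sum over the sites, in which the
    factors at the other sites are evaluated at the identity. *)
Lemma rho_deriv (rot : R -> ambient R G)
    (dD : forall s : spin G, Mell s -> Mell s -> C) : rot 0 = 1 ->
    (forall s mu m, has_cderiv0 (fun t => D s (rot t) mu m) (dD s mu m)) ->
  exists drho : 'M[C]_#|{: M}|, mx_cderiv 0 (fun t => rho_mx (rot t)) drho /\
    forall (A : M -> C) b, \sum_a A (enum_val a) * drho a b =
      site_op (fun k a b => dD (ell k) (inord a) (inord b)) A (enum_val b).
Proof.
move=> rot0 hdD.
pose dn (i : 'I_N) (m m' : M) :=
  dD (ell (tnth l i)) (inord (mval m i)) (inord (mval m' i)).
pose dr (m m' : M) := \sum_i dn i m m' *
   \prod_(k | k != i) Dnat (rot 0) (tnth l k) (mval m k) (mval m' k).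
exists (\matrix_(a, b) dr (enum_val a) (enum_val b)); split.
  move=> a b; rewrite mxE.
  have := @has_cderiv_prod R 0 _ (index_enum 'I_N)
    (fun i t => Dnat (rot t) (tnth l i) (mval (enum_val a) i) (mval (enum_val b) i))
    (fun i => dn i (enum_val a) (enum_val b)) (index_enum_uniq _).
  move=> /(_ (fun i => hdD _ _ _)); congr (has_cderiv _ _ _).
  by apply/funext => t; rewrite mxE.
move=> A b; under eq_bigr => a _ do rewrite mxE.
rewrite (sum_enum_mtuple (fun m => A m * dr m (enum_val b))).
move: (enum_val b) => m'; rewrite /dr.
under eq_bigr => m _ do rewrite mulr_sumr.
rewrite exchange_big /=; apply: eq_bigr => i _.
transitivity (\sum_(0 <= a < (dim_ (tnth l i)).+1)
   A (upd m' i a) * dn i (upd m' i a) m'); last first.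
  by apply: eq_big_nat => a /= ha; rewrite /dn updE // eqxx.
rewrite (sum_upd (fun m => A m * dn i m m')) [RHS]big_mkcond /=.
apply: eq_bigr => m _; rewrite rot0.
have -> : \prod_(k < N | k != i) Dnat 1 (tnth l k) (mval m k) (mval m' k) =
    (agree_off i m' m)%:R.
  rewrite /agree_off -prodr_bool big_mkcond /=; apply: eq_bigr => k _.
  case: ifP => //= _; rewrite Dnat1 // -1?ltnS ?mtuple_lt //.
  by case: eqP.
by case: agree_off; rewrite ?mulr1 // !mulr0.
Qed.

End TensorRepresentation.

(** * Equivariance in terms of coefficients *)

Section Equivariance.
Variables (R : realType) (G : rotation_group) (disp : Order.disp_t).
Variables (LI : orderType disp) (ell : LI -> spin G).
Variables (N : nat) (l : N.-tuple LI).
Notation M := (Mtuple ell l).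
Notation C := (R[i]).
Notation dim_ k := (twice (ell k)).
Variable D : forall s : spin G, ambient R G -> 'M[C]_((twice s).+1).
Hypothesis hD : is_wignerD D.
Variable L : spin G.
Implicit Type A : nat -> M -> C.

Definition coef_mx A : 'M[C]_((twice L).+1, #|{: M}|) :=
  \matrix_(K, b) A K (enum_val b).

Definition intertwines A : Prop := forall Q, in_group Q ->
  coef_mx A *m rho_mx ell l D Q = D L Q *m coef_mx A.

Definition inf_intertwines (dD : forall s : spin G, Mell s -> Mell s -> C) A : Prop :=
  forall (K : Mell L) m,
    site_op (fun k a b => dD (ell k) (inord a) (inord b)) (A K) m =
    \sum_K' dD L K K' * A K' m.

Section OneRotation.
Variables (rot : R -> ambient R G).
Variable (dD : forall s : spin G, Mell s -> Mell s -> C).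
Hypothesis rot0 : rot 0 = 1.
Hypothesis rotD : forall s t, rot (s + t) = rot s * rot t.
Hypothesis rot_in : forall t, in_group (rot t).
Hypothesis hdD : forall s mu m, has_cderiv0 (fun t => D s (rot t) mu m) (@dD s mu m).

Let drho_ex := rho_deriv ell l hD (dD := @dD) rot0 hdD.

Let DL_deriv : mx_cderiv 0 (fun t => D L (rot t)) (\matrix_(K, K') @dD L K K').
Proof. by move=> K K'; rewrite mxE; apply: hdD. Qed.

Let inf_intertwinesP A (drho : 'M[C]_#|{: M}|) :
  (forall (B : M -> C) b, \sum_a B (enum_val a) * drho a b =
      site_op (fun k a b => @dD (ell k) (inord a) (inord b)) B (enum_val b)) ->
  inf_intertwines (@dD) A <->
  coef_mx A *m drho = (\matrix_(K, K') @dD L K K') *m coef_mx A.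
Proof.
move=> hdr; split=> [h|/matrixP h].
  apply/matrixP => K b; rewrite !mxE.
  under eq_bigr => a _ do rewrite mxE.
  by rewrite hdr h; apply: eq_bigr => K' _; rewrite !mxE.
move=> K m; have := h K (enum_rank m); rewrite !mxE.
under eq_bigr => a _ do rewrite mxE.
rewrite hdr enum_rankK => ->; apply: eq_bigr => K' _.
by rewrite !mxE enum_rankK.
Qed.

Lemma intertwines_one_parameter A : inf_intertwines (@dD) A ->
  forall t, coef_mx A *m rho_mx ell l D (rot t) = D L (rot t) *m coef_mx A.
Proof.
have [drho [hX hdr]] := drho_ex.
move=> /(inf_intertwinesP _ hdr) hA.
apply: (one_parameter_intertwine (X := fun t => rho_mx ell l D (rot t))
  (Y := fun t => D L (rot t)) _ _ hX _ _ DL_deriv hA).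
- by rewrite rot0 rho1.
- by move=> s t; rewrite rotD rhoM.
- by rewrite rot0 (wignerD1 hD).
- by move=> s t; rewrite rotD (wignerDM hD).
Qed.

Lemma intertwines_deriv A :
  (forall t, coef_mx A *m rho_mx ell l D (rot t) = D L (rot t) *m coef_mx A) ->
  inf_intertwines (@dD) A.
Proof.
have [drho [hX hdr]] := drho_ex.
move=> h; apply/(inf_intertwinesP _ hdr).
have h1 := mx_cderivM (mx_cderiv_cst 0 (coef_mx A)) hX.
have h2 := mx_cderivM DL_deriv (mx_cderiv_cst 0 (coef_mx A)).
rewrite mul0mx add0r in h1; rewrite mulmx0 addr0 in h2.
apply/matrixP => i j; apply: (has_cderiv_unique (h1 i j)).
have := h2 i j; congr (has_cderiv _ _ _).
by apply/funext => t; rewrite h.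
Qed.

End OneRotation.

(** The elements that satisfy the relation are closed under products, and the
    two one-parameter groups generate. *)
Lemma intertwinesP A : intertwines A <->
  inf_intertwines (@dDZ R G) A /\ inf_intertwines (@dDY R G) A.
Proof.
split=> [h|[hZ hY]].
  have hZ t := h _ (in_group_rotZ G t); have hY t := h _ (in_group_rotY G t).
  split.
    exact: (intertwines_deriv (rotZ0 R G) (@wignerD_dZ _ _ _ hD) hZ).
  exact: (intertwines_deriv (rotY0 R G) (@wignerD_dY _ _ _ hD) hY).
apply: group_generated => [t|t|Q Q' hQ hQ' PQ PQ'].
- exact: (intertwines_one_parameter (rotZ0 R G) (@rotZD R G) (@in_group_rotZ R G)
    (@wignerD_dZ _ _ _ hD) hZ).
- exact: (intertwines_one_parameter (rotY0 R G) (@rotYD R G) (@in_group_rotY R G)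
    (@wignerD_dY _ _ _ hD) hY).
- by rewrite rhoM // mulmxA PQ -mulmxA PQ' mulmxA (wignerDM hD).
Qed.

Variables (Omega : Type) (F : comAlgType C) (act : ambient R G -> Omega -> Omega).
Variable (phi : forall k : LI, Mell (ell k) -> Omega -> F).
Hypothesis hphi : phi_equivariant phi act D.

Lemma phibar_act Q (m : M) r : in_group Q ->
  phibar phi m (fun i => act Q (r i)) =
  \sum_m' rho D Q m m' *: phibar phi m' r.
Proof.
move=> hQ; rewrite phibarE.
transitivity (\prod_i \sum_(0 <= b < (dim_ (tnth l i)).+1)
    Dnat ell D Q (tnth l i) (mval m i) b *: \sum_j phin phi (tnth l i) b (r j)).
  apply: eq_bigr => i _.
  under [RHS]eq_bigr => b _ do rewrite scaler_sumr.
  rewrite exchange_big /=; apply: eq_bigr => j _.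
  rewrite /phin hphi // big_mkord; apply: eq_bigr => b _.
  by rewrite /Dnat inord_val.
rewrite prod_sum_mtuple; apply: eq_bigr => m' _.
by rewrite scaler_prod phibarE.
Qed.

Definition combination (B : M -> C) : ('I_N -> Omega) -> F :=
  \sum_m B m *: phibar phi m.

Lemma combinationE B r : combination B r = \sum_m B m *: phibar phi m r.
Proof. by rewrite /combination fct_sumE. Qed.

Lemma combination_act Q B r : in_group Q ->
  combination B (fun i => act Q (r i)) =
  combination (fun m' => \sum_m B m * rho D Q m m') r.
Proof.
move=> hQ; rewrite !combinationE.
under eq_bigr => m _ do rewrite phibar_act // scaler_sumr.
rewrite exchange_big /=; apply: eq_bigr => m' _.
by rewrite scaler_suml; apply: eq_bigr => m _; rewrite scalerA.
Qed.

Definition family A : Mell L -> ('I_N -> Omega) -> F := fun K => combination (A K).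

Lemma family_action Q A (K : Mell L) r :
  \sum_K' D L Q K K' *: family A K' r =
  combination (fun m => \sum_K' D L Q K K' * A K' m) r.
Proof.
rewrite combinationE /family.
under eq_bigr => K' _ do rewrite combinationE scaler_sumr.
rewrite exchange_big /=; apply: eq_bigr => m _.
by rewrite scaler_suml; apply: eq_bigr => K' _; rewrite scalerA.
Qed.

Let intertwines_entry Q A : in_group Q ->
  coef_mx A *m rho_mx ell l D Q = D L Q *m coef_mx A <->
  forall (K : Mell L) m', \sum_m A K m * rho D Q m m' = \sum_K' D L Q K K' * A K' m'.
Proof.
move=> hQ; split=> [/matrixP h K m'|h].
  have := h K (enum_rank m'); rewrite !mxE.
  under eq_bigr => a _ do rewrite !mxE enum_rankK.
  under [X in _ = X -> _]eq_bigr => a _ do rewrite !mxE enum_rankK.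
  by rewrite (sum_enum_mtuple (fun m => A K m * rho D Q m m')).
apply/matrixP => K b; rewrite !mxE.
under eq_bigr => a _ do rewrite !mxE.
under [RHS]eq_bigr => a _ do rewrite !mxE.
by rewrite (sum_enum_mtuple (fun m => A K m * rho D Q m (enum_val b))).
Qed.

Lemma intertwines_VbarL A : intertwines A -> VbarL l phi act D (family A).
Proof.
move=> h; split=> [K|Q r hQ K]; first by exists (A K).
rewrite family_action /family combination_act //.
have /(intertwines_entry _ hQ) e := h Q hQ.
by rewrite !combinationE; apply: eq_bigr => m _; rewrite e.
Qed.

Variables (H : set (Omega -> F)) (ip : (Omega -> F) -> (Omega -> F) -> C).
Variables (HN : set (('I_N -> Omega) -> F)).
Variable (ipN : (('I_N -> Omega) -> F) -> (('I_N -> Omega) -> F) -> C).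
Hypothesis (hortho : phi_orthonormal phi H ip).
Hypothesis (hipN : tensor_scalar_product H ip HN ipN).
Hypothesis (hN : (0 < N)%N).

(** Equivariance equates two combinations of the symmetrized products. Their
    coefficients are class invariant, hence equal. *)
Lemma VbarL_intertwines A : (forall K, class_invariant (A K)) ->
  VbarL l phi act D (family A) -> intertwines A.
Proof.
move=> hA [_ h] Q hQ; apply/(intertwines_entry _ hQ) => K m'.
pose B m := \sum_m0 A K m0 * rho D Q m0 m - \sum_K' D L Q K K' * A K' m.
suff : B m' = 0 by move/eqP; rewrite subr_eq0 => /eqP.
apply: (phibar_free hortho hipN hN) => {m'}.
  move=> m m' mm'; rewrite /B (rho_invariant D Q (hA K) mm'); congr (_ - _).
  by apply: eq_bigr => K' _; rewrite (hA K' _ _ mm').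
apply/funext => r; have := h Q r hQ K; rewrite family_action {1}/family combination_act //.
move/eqP; rewrite -subr_eq0 => /eqP e; rewrite -[RHS]e !combinationE fct_sumE -sumrB.
by apply: eq_bigr => m _; rewrite -scalerBl.
Qed.

(** The coefficients are averaged over the classes. *)
Lemma Vbar_class_invariant g : Vbar l phi g ->
  exists2 B : M -> C, class_invariant B & g = combination B.
Proof.
case=> a ->.
pose B m := (class_size m)%:R^-1 * \sum_(m' | mequiv m m') a m'.
exists B => [m m' mm'|].
  by rewrite /B (eq_bigl _ _ (mequiv_eql mm')) (class_size_invariant mm').
rewrite /combination /B.
under [RHS]eq_bigr => m _ do rewrite mulr_sumr scaler_suml.
rewrite (exchange_big_dep xpredT) //=; apply: eq_bigr => m' _.
rewrite (eq_bigr (fun=> ((class_size m')%:R^-1 * a m') *: phibar phi m')).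
  rewrite sumr_const -scaler_nat scalerA.
  have -> : #|[pred m | mequiv m m']| = class_size m'.
    by apply: eq_card => m2; rewrite !inE mequiv_sym.
  by rewrite mulrA mulfV ?mul1r // class_size_neq0.
by move=> m mm'; rewrite (phibar_class phi mm') (class_size_invariant mm').
Qed.

End Equivariance.

(** * The infinitesimal relations *)

Section StringRelations.
Variables (R : realType) (G : rotation_group) (disp : Order.disp_t).
Variables (LI : orderType disp) (ell : LI -> spin G).
Variables (N : nat) (l : N.-tuple LI).
Notation M := (Mtuple ell l).
Notation C := (R[i]).
Notation dim_ k := (twice (ell k)).
Variable L : spin G.
Let d := twice L.
Implicit Type A : nat -> M -> C.

(** The action of the Lie algebra on the standard basis of the irreducible
    representation of spin [L]. *)
Definition string_relations A : Prop :=
  [/\ forall k, (k <= d)%N -> wt_supp (k%:R - d%:R / 2) (A k),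
      forall k m, (k < d)%N -> lower (A k.+1) m = (ladder_coef R d k)%:C * A k m,
      forall k m, (k < d)%N -> raise (A k) m = (ladder_coef R d k)%:C * A k.+1 m,
      forall m, raise (A d) m = 0 & forall m, lower (A 0%N) m = 0].

Lemma eq_site_op_coef (x y : LI -> nat -> nat -> C) (B : M -> C) m :
  (forall k a b, (a <= dim_ k)%N -> (b <= dim_ k)%N -> x k a b = y k a b) ->
  site_op x B m = site_op y B m.
Proof.
move=> h; apply: eq_bigr => i _; apply: eq_big_nat => a /= ha.
by rewrite h // -ltnS mtuple_lt.
Qed.

Lemma site_op_scale c (x : LI -> nat -> nat -> C) (B : M -> C) m :
  site_op (fun k a b => c * x k a b) B m = c * site_op x B m.
Proof.
rewrite /site_op mulr_sumr; apply: eq_bigr => i _; rewrite mulr_sumr.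
by apply: eq_bigr => a _; rewrite mulrCA.
Qed.

Lemma site_opB (x y : LI -> nat -> nat -> C) (B : M -> C) m :
  site_op (fun k a b => x k a b - y k a b) B m = site_op x B m - site_op y B m.
Proof.
rewrite /site_op -sumrB; apply: eq_bigr => i _; rewrite -sumrB.
by apply: eq_bigr => a _; rewrite mulrBr.
Qed.

Lemma dDYE (s : spin G) (mu m : Mell s) : dDY R mu m =
  (2^-1)%:C * ((if m == mu.+1 :> nat then (ladder_coef R (twice s) mu)%:C else 0) -
               (if mu == m.+1 :> nat then (ladder_coef R (twice s) m)%:C else 0)).
Proof.
have hm : (m <= twice s)%N by rewrite -ltnS.
have hmu : (mu <= twice s)%N by rewrite -ltnS.
rewrite /dDY /weight.
have -> : ((m : nat)%:R - spinr R s == (mu : nat)%:R - spinr R s + 1) = (m == mu.+1 :> nat).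
  by rewrite addrAC (inj_eq (addIr _)) natr1 eqr_nat.
have -> : ((m : nat)%:R - spinr R s == (mu : nat)%:R - spinr R s - 1) = (mu == m.+1 :> nat).
  by rewrite addrAC (inj_eq (addIr _)) eq_sym subr_eq natr1 eqr_nat.
case: eqP => [e|ne].
  have -> : (mu == m.+1 :> nat) = false by apply/eqP; lia.
  rewrite subr0 -rmorphM; congr ((_ * Num.sqrt _)%:C).
  by rewrite /spinr natrB // e -!natr1; field.
case: eqP => [e|ne']; last by rewrite subr0 mulr0.
rewrite sub0r mulrN -rmorphM -rmorphN; congr ((- (_ * Num.sqrt _))%:C).
by rewrite /spinr natrB // -!natr1; field.
Qed.

Lemma site_op_dDZ (B : M -> C) m :
  site_op (fun k a b => @dDZ R G (ell k) (inord a) (inord b)) B m =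
  (0 -i* wt R m) * B m.
Proof.
pose x k a b := if a == b :> nat then ((b%:R - (dim_ k)%:R / 2)%:C : C) else 0.
rewrite (@eq_site_op_coef _ (fun k a b => (0 -i* 1) * x k a b)); last first.
  move=> k a b ha hb; rewrite /dDZ /x /weight -(inj_eq val_inj) /= !inordK //.
  case: eqP => _; rewrite ?mulr0 //.
  by apply/eqP; rewrite eq_complex /=; apply/andP; split; apply/eqP; rewrite /spinr; ring.
rewrite site_op_scale (@site_op_diag _ _ _ _ _ _ _ x (fun k b => b%:R - (dim_ k)%:R / 2)) //.
rewrite mulrA -/(wt R m); congr (_ * _).
by apply/eqP; rewrite eq_complex /=; apply/andP; split; apply/eqP; ring.
Qed.

Lemma site_op_dDY (B : M -> C) m :
  site_op (fun k a b => @dDY R G (ell k) (inord a) (inord b)) B m =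
  (2^-1)%:C * (raise B m - lower B m).
Proof.
rewrite (@eq_site_op_coef _
   (fun k a b => (2^-1)%:C * (raise_coef R ell k a b - lower_coef R ell k a b))).
  by rewrite site_op_scale site_opB.
by move=> k a b ha hb; rewrite dDYE !inordK.
Qed.

Lemma sum_dDZ A (K : Mell L) m :
  \sum_K' dDZ R K K' * A K' m = (0 -i* (K%:R - d%:R / 2)) * A K m.
Proof.
rewrite (bigD1 K) //= big1 ?addr0; first by rewrite /dDZ eqxx.
by move=> K' /negbTE hK; rewrite /dDZ eq_sym hK mul0r.
Qed.

Let up A (k : nat) m : C := if (k < d)%N then (ladder_coef R d k)%:C * A k.+1 m else 0.
Let down A (k : nat) m : C :=
  if k is k'.+1 then (ladder_coef R d k')%:C * A k' m else 0.

Lemma sum_dDY A (K : Mell L) m :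
  \sum_K' dDY R K K' * A K' m = (2^-1)%:C * (up A K m - down A K m).
Proof.
under eq_bigr => K' _ do rewrite dDYE -mulrA mulrBl.
rewrite -mulr_sumr sumrB; congr (_ * (_ - _)).
  rewrite -(big_mkord xpredT (fun K' => (if K' == K.+1 then
    (ladder_coef R d K)%:C else 0) * A K' m)).
  rewrite (eq_bigr (fun K' => if K' == K.+1 then
    (ladder_coef R d K)%:C * A K.+1 m else 0)).
    by rewrite -big_mkcond big_nat1_eq /= ltnS.
  by move=> K' _; case: eqP => [->|]; rewrite ?mul0r.
rewrite -(big_mkord xpredT (fun K' => (if K == K'.+1 :> nat then
  (ladder_coef R d K')%:C else 0) * A K' m)) /down.
have := ltn_ord K; case: (nat_of_ord K) => [|k] hk.
  by rewrite big1 // => K' _; rewrite /= mul0r.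
rewrite (eq_bigr (fun K' => if K' == k then
    (ladder_coef R d k)%:C * A k m else 0)).
  by rewrite -big_mkcond big_nat1_eq /= ltnW.
by move=> K' _; rewrite eqSS eq_sym; case: eqP => [->|]; rewrite ?mul0r.
Qed.

(** Along [z] the relation says that [A k] has weight [k - d / 2]; along [y] it
    equates a raising and a lowering part, which have different weights and can
    therefore be compared separately. *)
Lemma inf_intertwines_string A :
  (inf_intertwines L (@dDZ R G) A /\ inf_intertwines L (@dDY R G) A) <->
  string_relations A.
Proof.
have half0 : (2^-1)%:C != 0 :> C.
  by apply/eqP => /complexI /eqP; rewrite invr_eq0 pnatr_eq0.
have ord_le k : (k <= d)%N -> exists K : Mell L, k = K.
  by move=> hk; exists (Ordinal (hk : (k < d.+1)%N)).
split=> [[hZ hY]|[hs hl hr htop hbot]]; last first.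
  have hup k m : (k <= d)%N -> raise (A k) m = up A k m.
    rewrite /up; case: (ltnP k d) => [/hr //|h1 h2].
    by have -> : k = d by apply/eqP; rewrite eqn_leq h2 h1.
  have hdown k m : (k <= d)%N -> lower (A k) m = down A k m.
    by case: k => [|k] hk; [apply: hbot | apply: hl].
  split=> K m.
    rewrite site_op_dDZ sum_dDZ.
    have hK : (K <= d)%N by rewrite -ltnS.
    by case: (pselect (wt R m = K%:R - d%:R / 2)) => [->//|/(hs _ hK) ->]; rewrite !mulr0.
  by rewrite site_op_dDY sum_dDY hup ?hdown // -ltnS.
have hs k : (k <= d)%N -> wt_supp (k%:R - d%:R / 2) (A k).
  case/ord_le => K -> m hm; have := hZ K m; rewrite site_op_dDZ sum_dDZ.
  move/eqP; rewrite -subr_eq0 -mulrBl mulf_eq0 => /orP[|/eqP //].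
  rewrite eq_complex /= => /andP[_ /eqP h]; case: hm; lra.
have hsucc k : k.+1%:R - d%:R / 2 = k%:R - d%:R / 2 + 1 :> R by rewrite -natr1; ring.
have up_supp k : (k <= d)%N -> wt_supp (k%:R - d%:R / 2 + 1) (up A k).
  move=> hk m hm; rewrite /up; case: ltnP => // hk'.
  by rewrite (hs k.+1) ?mulr0 // hsucc.
have down_supp k : (k <= d)%N -> wt_supp (k%:R - d%:R / 2 - 1) (down A k).
  case: k => [|k] hk m hm //=; rewrite (hs k) ?mulr0 ?(ltnW hk) //.
  by move=> e; apply: hm; rewrite e hsucc addrK.
have hdiff k m : (k <= d)%N -> raise (A k) m - lower (A k) m = up A k m - down A k m.
  case/ord_le => K ->; have := hY K m; rewrite site_op_dDY sum_dDY.
  exact: mulfI.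
have hraise k m : (k <= d)%N -> raise (A k) m = up A k m.
  move=> hk; case: (pselect (wt R m = k%:R - d%:R / 2 + 1)) => [e|ne].
    have ne : wt R m <> k%:R - d%:R / 2 - 1 by rewrite e; lra.
    have := hdiff k m hk.
    by rewrite (wt_supp_lower (hs k hk) ne) (down_supp k hk m ne) !subr0.
  by rewrite (up_supp k hk m ne); apply: (wt_supp_raise (hs k hk)).
have hlower k m : (k <= d)%N -> lower (A k) m = down A k m.
  move=> hk; have /eqP := hdiff k m hk; rewrite hraise //.
  by rewrite (inj_eq (addrI _)) (inj_eq oppr_inj) => /eqP.
split=> // [k m hk|k m hk|m|m].
- by rewrite hlower.
- by rewrite hraise ?(ltnW hk) // /up hk.
- by rewrite hraise // /up ltnn.
- by rewrite hlower.
Qed.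

End StringRelations.

(** * The kernel of the matrix *)

Section Kernel.
Variables (R : realType) (G : rotation_group) (disp : Order.disp_t).
Variables (LI : orderType disp) (ell : LI -> spin G).
Variables (N : nat) (l : N.-tuple LI).
Notation M := (Mtuple ell l).
Notation C := (R[i]).
Notation cls m := (\pi_(Mclass ell l) m)%qT.
Variable blocks : seq (LI * nat).
Hypothesis hblocks : minimal_partition l blocks.
Variable L : spin G.
Let d := twice L.
Notation W k := (k%:R - d%:R / 2).
Notation cols := (Mbar_le R ell l L).
Notation rows := (Mbar_rows R ell l L).

Lemma cls_eqP (m m' : M) : (cls m = cls m') <-> mequiv m m'.
Proof. by split=> [/eqP|h]; [rewrite pi_mequivP|apply/eqP; rewrite pi_mequivP]. Qed.

Lemma mequiv_repr (m : M) : mequiv (repr (cls m)) m.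
Proof. by apply/cls_eqP; rewrite reprK. Qed.

Lemma cls_invariant T (g : Mclass ell l -> T) : class_invariant (fun m : M => g (cls m)).
Proof. by move=> m m' /cls_eqP ->. Qed.

Lemma sum_over_class (V : lmodType C) (h : M -> V) (x : Mclass ell l) :
  class_invariant h -> \sum_(m | cls m == x) h m = (class_size (repr x))%:R *: h (repr x).
Proof.
move=> hh; have e m : (cls m == x) = mequiv (repr x) m.
  by rewrite -[x in LHS]reprK pi_mequivP mequiv_sym.
rewrite (eq_bigl _ _ e) (eq_bigr (fun=> h (repr x))) => [|m hm]; last first.
  by apply/esym/hh.
rewrite sumr_const -scaler_nat; congr (_%:R *: _).
by apply: eq_card => m; rewrite !inE.
Qed.

Lemma sum_classes (V : lmodType C) (h : M -> V) : class_invariant h ->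
  \sum_(x : Mclass ell l) h (repr x) = \sum_m (class_size m)%:R^-1 *: h m.
Proof.
move=> hh; rewrite [RHS](partition_big (fun m : M => cls m) xpredT) //=.
apply: eq_bigr => x _; rewrite sum_over_class.
  by rewrite scalerA mulfV ?scale1r // class_size_neq0.
by move=> m m' mm'; rewrite (hh _ _ mm') (class_size_invariant mm').
Qed.

Lemma Msum_wt (x : Mclass ell l) : Msum R x = wt R (repr x).
Proof. by []. Qed.

Lemma Msum_cls (m : M) : Msum R (cls m) = wt R m.
Proof. by rewrite Msum_wt; apply/wt_invariant/mequiv_repr. Qed.

Lemma weight_inj k k' : W k = W k' :> R -> k = k'.
Proof. by move=> /addIr /eqP; rewrite eqr_nat => /eqP. Qed.

Lemma in_cols x : (x \in cols) = [exists K : Mell L, Msum R x == W (K : nat)].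
Proof.
apply/bigcupP/existsP => [[K _]|[K hK]]; first by rewrite inE => h; exists K.
by exists K; rewrite ?inE.
Qed.

Lemma spinrE : spinr R L = W d.
Proof. by rewrite /spinr -/d; field. Qed.

Lemma spinrS : spinr R L + 1 = W d.+1.
Proof. by rewrite spinrE -natr1; ring. Qed.

Lemma weight_top (K : Mell L) : (weight R K != spinr R L) = (K < d)%N.
Proof.
rewrite spinrE /weight (inj_eq (addIr _)) eqr_nat ltn_neqAle.
by have := ltn_ord K; rewrite ltnS => ->; rewrite andbT.
Qed.

Lemma in_rows x : reflect
  ((exists2 k, (k < d)%N & Msum R x = W k) \/ Msum R x = W d.+1) (x \in rows).
Proof.
rewrite inE; apply: (iffP orP) => [[/bigcupP[K hK]|]|[[k hk hx]|hx]].
- by rewrite inE => /eqP hx; left; exists (nat_of_ord K); rewrite // -weight_top.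
- by rewrite inE spinrS => /eqP; right.
- left; apply/bigcupP; have hk' : (k < d.+1)%N by rewrite ltnS ltnW.
  by exists (Ordinal hk'); rewrite ?weight_top ?inE /weight ?hx.
- by right; rewrite inE spinrS hx.
Qed.

Definition extend0 (S : {set Mclass ell l}) (c : 'I_#|S| -> C) (x : Mclass ell l) : C :=
  \sum_(a | enum_val a == x) c a.

Lemma extend0_val (S : {set Mclass ell l}) (c : 'I_#|S| -> C) a : extend0 c (enum_val a) = c a.
Proof.
rewrite /extend0 (big_pred1 a) // => b; exact: (inj_eq enum_val_inj).
Qed.

Lemma extend0_out (S : {set Mclass ell l}) (c : 'I_#|S| -> C) x : x \notin S -> extend0 c x = 0.
Proof.
move=> hx; rewrite /extend0 big_pred0 // => a.
by apply/negbTE; apply: contraNneq hx => <-; apply: enum_valP.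
Qed.

Lemma sum_extend0 (S : {set Mclass ell l}) (c : 'I_#|S| -> C) (V : lmodType C) (g : Mclass ell l -> V) :
  \sum_a c a *: g (enum_val a) = \sum_x extend0 c x *: g x.
Proof.
under [RHS]eq_bigr => x _ do rewrite scaler_suml.
rewrite (exchange_big_dep xpredT) //=; apply: eq_bigr => a _.
by rewrite (big_pred1 (enum_val a)).
Qed.

(** The tuple coefficients of the component [k] of [bvec c]: a class coefficient
    is spread evenly over the tuples of the class. *)
Definition fam (c : 'cV[C]_#|cols|) (k : nat) (m : M) : C :=
  if wt R m == W k then (class_size m)%:R^-1 * extend0 (c ^~ ord0) (cls m) else 0.

Lemma fam_invariant c k : class_invariant (fam c k).
Proof.
move=> m m' mm'; rewrite /fam (wt_invariant R mm') (class_size_invariant mm').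
by have /cls_eqP -> := mm'.
Qed.

Lemma fam_supp c k : wt_supp (W k) (fam c k).
Proof. by move=> m /eqP/negbTE h; rewrite /fam h. Qed.

(** Duality between the two ways of reading a matrix of transition rates
    between classes: summing over rows gives a site operator on functions that
    are constant on classes; summing over columns gives the transposed operator,
    once a class coefficient is spread evenly over the tuples of the class. *)
Lemma sum_col (e : Mclass ell l -> Mclass ell l -> R) (op : LI -> nat -> nat -> C)
    (g : Mclass ell l -> C) x :
    (forall (y : Mclass ell l -> C) (m : M),
       \sum_x y x * (e x (cls m))%:C = site_op op (fun m' => y (cls m')) m) ->
  \sum_x' (e x x')%:C * g x' =
  (class_size (repr x))%:R * site_op (fun k a b => op k b a)
    (fun m : M => (class_size m)%:R^-1 * g (cls m)) (repr x).
Proof.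
move=> he; pose delta y : C := (y == x)%:R.
pose dop := site_op op (fun m : M => delta (cls m)).
transitivity (\sum_(x' : Mclass ell l) g x' * dop (repr x')).
  apply: eq_bigr => x' _; rewrite mulrC; congr (_ * _).
  rewrite /dop -(he delta) reprK (bigD1 x) //= /delta eqxx mul1r.
  by rewrite big1 ?addr0 // => y /negbTE ->; rewrite mul0r.
pose h (m : M) : C^o := g (cls m) * dop m.
transitivity (\sum_(x' : Mclass ell l) h (repr x')); first by apply: eq_bigr => x' _; rewrite /h reprK.
have hinv : class_invariant dop by apply/site_op_invariant/cls_invariant.
rewrite sum_classes; last by move=> m m' mm'; rewrite /h (hinv _ _ mm') (cls_invariant g mm').
transitivity (\sum_m dop m * ((class_size m)%:R^-1 * g (cls m))).
  by apply: eq_bigr => m _; rewrite /h /GRing.scale /= mulrA mulrC.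
rewrite site_op_transpose.
rewrite (eq_bigr (fun m => if cls m == x then site_op (fun k a b => op k b a)
   (fun m : M => (class_size m)%:R^-1 * g (cls m)) m else 0)); last first.
  by move=> m _; rewrite /delta; case: eqP => _; rewrite ?mul1r ?mul0r.
rewrite -big_mkcond (@sum_over_class C^o) //; apply: site_op_invariant.
by move=> m m' mm'; rewrite (class_size_invariant mm') (cls_invariant g mm').
Qed.

Lemma fam_restrict c k m :
  fam c k m = (class_size m)%:R^-1 *
    (if Msum R (cls m) == W k then extend0 (c ^~ ord0) (cls m) else 0).
Proof. by rewrite /fam Msum_cls; case: ifP => //; rewrite mulr0. Qed.

Lemma Mup_row (c : 'cV[C]_#|cols|) (a : 'I_#|rows|) :
  (Mup R ell l blocks L *m c) a ord0 =
  \sum_x' (Mup_entry R blocks L (enum_val a) x')%:C * extend0 (c ^~ ord0) x'.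
Proof.
rewrite mxE; under eq_bigr => b _ do rewrite mxE mulrC.
have := @sum_extend0 cols (c ^~ ord0) C^o (fun x' => (Mup_entry R blocks L (enum_val a) x')%:C).
by rewrite /GRing.scale /= => ->; apply: eq_bigr => x' _; rewrite mulrC.
Qed.

Lemma row_low (c : 'cV[C]_#|cols|) x k : (k < d)%N -> Msum R x = W k ->
  \sum_x' (Mup_entry R blocks L x x')%:C * extend0 (c ^~ ord0) x' =
  (class_size (repr x))%:R *
    ((ladder_coef R d k)%:C * fam c k (repr x) - lower (fam c k.+1) (repr x)).
Proof.
move=> hk hx.
have wS : W k.+1 = W k + 1 :> R by rewrite -natr1; ring.
transitivity (\sum_x' ((if x' == x then (ladder_coef R d k)%:C * extend0 (c ^~ ord0) x else 0) -
   (up_entry R blocks x x')%:C * (if Msum R x' == W k.+1 then extend0 (c ^~ ord0) x' else 0))).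
  apply: eq_bigr => x' _; rewrite /Mup_entry hx spinrS.
  case: eqP => [/weight_inj e|_]; first by move: hk; rewrite e; lia.
  have hs : Num.sqrt ((spinr R L + W k + 1) * (spinr R L - W k)) = ladder_coef R d k.
    rewrite /ladder_coef; congr Num.sqrt.
    by rewrite spinrE natrB ?(ltnW hk) // -natr1; field.
  rewrite hs -wS; case: (eqVneq x' x) => [->|xx'].
    rewrite hx eqxx mulr1; case: eqP => [/weight_inj|_]; first by lia.
    by rewrite mulr0 subr0.
  rewrite mulr0 sub0r.
  case: eqP => [->|_].
    case: eqP => [/weight_inj|_]; first by lia.
    by rewrite mulr0 oppr0 mul0r.
  by case: eqP => _; rewrite ?mulr0 ?oppr0 ?mul0r // rmorphN mulNr.
rewrite sumrB -big_mkcond big_pred1_eq.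
rewrite (sum_col _ _ (@sum_up_entry _ _ _ _ _ _ _ _ hblocks)) mulrBr; congr (_ - _).
  rewrite /fam -Msum_wt reprK hx eqxx mulrCA; congr (_ * _).
  by rewrite mulrA mulfV ?mul1r // class_size_neq0.
congr (_ * _); by apply: eq_site_op => m; rewrite fam_restrict.
Qed.

Lemma row_top (c : 'cV[C]_#|cols|) x : Msum R x = W d.+1 ->
  \sum_x' (Mup_entry R blocks L x x')%:C * extend0 (c ^~ ord0) x' =
  (class_size (repr x))%:R * raise (fam c d) (repr x).
Proof.
move=> hx.
transitivity (\sum_x' (down_entry R blocks x x')%:C *
   (if Msum R x' == W d then extend0 (c ^~ ord0) x' else 0)).
  apply: eq_bigr => x' _; rewrite /Mup_entry hx spinrS eqxx spinrE.
  by case: eqP => _; rewrite ?mul0r ?mulr0.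
rewrite (sum_col _ _ (@sum_down_entry _ _ _ _ _ _ _ _ hblocks)).
congr (_ * _); by apply: eq_site_op => m; rewrite fam_restrict.
Qed.

(** The equations of the kernel express that [lower] moves down along the
    string and that [raise] kills the top of it; the other relations follow. *)
Lemma Mup_ker_string (c : 'cV[C]_#|cols|) :
  Mup R ell l blocks L *m c = 0 <-> string_relations L (fam c).
Proof.
split=> [h|[_ hl _ ht _]].
  have h0 (a : 'I_#|rows|) : \sum_x' (Mup_entry R blocks L (enum_val a) x')%:C * extend0 (c ^~ ord0) x' = 0.
    by have := Mup_row c a; rewrite h mxE.
  have hrow x : x \in rows ->
      \sum_x' (Mup_entry R blocks L x x')%:C * extend0 (c ^~ ord0) x' = 0.
    by move=> hx; have := h0 (enum_rank_in hx x); rewrite enum_rankK_in.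
  have hlow k m : (k < d)%N -> lower (fam c k.+1) m = (ladder_coef R d k)%:C * fam c k m.
    move=> hk; case: (pselect (wt R m = W k)) => hm; last first.
      rewrite (fam_supp c hm) mulr0.
      apply: (wt_supp_lower (@fam_supp c k.+1)).
      by move=> e; apply: hm; rewrite e -natr1; ring.
    have hx : Msum R (cls m) = W k by rewrite Msum_cls.
    have := hrow (cls m); rewrite (row_low c hk hx) => /(_ _) e.
    have : cls m \in rows by apply/in_rows; left; exists k.
    move/e/eqP; rewrite mulf_eq0 (negbTE (class_size_neq0 _ _)) /= subr_eq0 => /eqP.
    rewrite (fam_invariant c k (mequiv_repr m)).
    by rewrite (lower_invariant (fam_invariant c k.+1) (mequiv_repr m)).
  have htop m : raise (fam c d) m = 0.
    case: (pselect (wt R m = W d.+1)) => hm; last first.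
      apply: (wt_supp_raise (@fam_supp c d)).
      by move=> e; apply: hm; rewrite e -natr1; ring.
    have hx : Msum R (cls m) = W d.+1 by rewrite Msum_cls.
    have : cls m \in rows by apply/in_rows; right.
    move/hrow; rewrite (row_top c hx) => /eqP.
    rewrite mulf_eq0 (negbTE (class_size_neq0 _ _)) /= => /eqP.
    by rewrite (raise_invariant (fam_invariant c d) (mequiv_repr m)).
  have hs k : (k <= d)%N -> wt_supp (W k) (fam c k) by move=> _; apply: fam_supp.
  have [hr hb] := lowering_string hs hlow htop.
  by split.
apply/matrixP => a j; rewrite ord1 Mup_row mxE.
case: (in_rows _ (enum_valP a)) => [[k hk hx]|hx].
  by rewrite (row_low c hk hx) hl // subrr mulr0.
by rewrite (row_top c hx) ht mulr0.
Qed.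

End Kernel.

(** * Basis and dimension *)

Section KernelBasis.
Variables (R : realType) (G : rotation_group) (disp : Order.disp_t).
Variables (LI : orderType disp) (ell : LI -> spin G).
Variables (N : nat) (l : N.-tuple LI).
Notation M := (Mtuple ell l).
Notation C := (R[i]).
Notation cls m := (\pi_(Mclass ell l) m)%qT.
Variable blocks : seq (LI * nat).
Hypothesis hblocks : minimal_partition l blocks.
Variable L : spin G.
Let d := twice L.
Notation W k := (k%:R - d%:R / 2).
Notation cols := (Mbar_le R ell l L).
Notation rows := (Mbar_rows R ell l L).

Lemma string_fam (A : nat -> M -> C) : (forall k, class_invariant (A k)) ->
    (forall k, (k <= d)%N -> wt_supp (W k) (A k)) ->
  exists c : 'cV[C]_#|cols|, forall k, (k <= d)%N -> fam c k =1 A k.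
Proof.
move=> hA hs.
(* The members of the family have different weights, so their sum determines
   them. *)
pose g (m : M) := (class_size m)%:R * \sum_(0 <= k < d.+1) A k m.
have hg : class_invariant g.
  move=> m m' mm'; rewrite /g (class_size_invariant mm'); congr (_ * _).
  by apply: eq_bigr => k _; apply: hA.
exists (\col_(a < #|cols|) g (repr (enum_val a : Mclass ell l))) => k hk m; rewrite /fam.
case: eqP => [hm|/(hs k hk) -> //].
have hc : cls m \in cols.
  rewrite in_cols; apply/existsP; exists (Ordinal (hk : (k < d.+1)%N)) => /=.
  by rewrite Msum_cls hm.
rewrite -(enum_rankK_in hc hc) extend0_val mxE enum_rankK_in //.
rewrite (hg _ _ (mequiv_repr m)) /g mulrA mulVf ?class_size_neq0 // mul1r.
rewrite (eq_big_nat _ _ (F2 := fun k' => if k' == k then A k m else 0)).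
  by rewrite -big_mkcond big_nat1_eq /= ltnS hk.
move=> k' /= hk'; case: eqP => [->//|ne]; apply: (hs k') => // e.
by apply: ne; apply: (weight_inj (R := R) (L := L)); rewrite -e hm.
Qed.

Lemma fam_linear (I : finType) (a : I -> C) (c : I -> 'cV[C]_#|cols|) k m :
  fam (\sum_i a i *: c i) k m = \sum_i a i * fam (c i) k m.
Proof.
rewrite /fam; case: ifP => _; last by rewrite big1 // => i _; rewrite mulr0.
rewrite /extend0 mulr_sumr; under [RHS]eq_bigr => i _ do rewrite !mulr_sumr.
rewrite exchange_big /=; apply: eq_bigr => b _.
by rewrite summxE mulr_sumr; apply: eq_bigr => i _; rewrite mxE mulrCA.
Qed.

Lemma fam_eq0 (c : 'cV[C]_#|cols|) :
  (forall k m, (k <= d)%N -> fam c k m = 0) -> c = 0.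
Proof.
move=> h; apply/matrixP => a j; rewrite ord1 mxE.
have := enum_valP a; rewrite in_cols => /existsP[K /eqP hK].
have hk : (K <= d)%N by rewrite -ltnS.
have := h K (repr (enum_val a)) hk; rewrite /fam -Msum_wt reprK hK eqxx => /eqP.
by rewrite mulf_eq0 invr_eq0 (negbTE (class_size_neq0 _ _)) extend0_val => /eqP.
Qed.

Lemma bvec_family (Omega : Type) (F : comAlgType C)
    (phi : forall k : LI, Mell (ell k) -> Omega -> F) (c : 'cV[C]_#|cols|) :
  bvec phi c = family phi (L := L) (fam c).
Proof.
apply/funext => K; rewrite /bvec /family /combination.
pose h m := ((class_size m)%:R * fam c K m) *: phibar phi m.
have hh : class_invariant h.
  move=> m m' mm'; rewrite /h (class_size_invariant mm') (fam_invariant c K mm').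
  by rewrite (phibar_class phi mm').
have -> : \sum_m fam c K m *: phibar phi m = \sum_m (class_size m)%:R^-1 *: h m.
  by apply: eq_bigr => m _; rewrite scalerA mulrA mulVf ?class_size_neq0 // mul1r.
rewrite -sum_classes // big_mkcond /=.
pose g (x : Mclass ell l) : ('I_N -> Omega) -> F :=
  if x \in MbarK ell l (weight R K) then phibar phi (repr x) else 0.
transitivity (\sum_a c a ord0 *: g (enum_val a)).
  by apply: eq_bigr => a _; rewrite /g; case: ifP => // _; rewrite scaler0.
rewrite sum_extend0; apply: eq_bigr => x _; rewrite /g /h /fam inE Msum_wt reprK /weight.
case: ifP => _; last by rewrite mulr0 scaler0 scale0r.
by rewrite mulrA mulfV ?class_size_neq0 // mul1r.
Qed.

Lemma Mup_entry_diag (x : Mclass ell l) k : (k < d)%N -> Msum R x = W k ->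
  Mup_entry R blocks L x x = ladder_coef R d k.
Proof.
move=> hk hx; rewrite /Mup_entry hx spinrS.
case: eqP => [/weight_inj e|_]; first by move: hk; rewrite e; lia.
rewrite !eqxx mulr1 /ladder_coef; congr Num.sqrt.
by rewrite spinrE natrB ?(ltnW hk) // -natr1; field.
Qed.

(** The matrix is block triangular with invertible diagonal blocks except for
    the last column block. So a vector of the left kernel vanishes on the rows of
    weight less than [L]; on the rows of weight [L + 1] it is, read through the
    transposed transition rates, a vector of positive weight killed by [lower]. *)
Lemma Mup_row_free : row_free (Mup R ell l blocks L).
Proof.
apply: inj_row_free => y hy.
pose g x := extend0 (fun a => y ord0 a) x.
have hcol x' : x' \in cols ->
    \sum_x g x * (Mup_entry R blocks L x x')%:C = 0.
  move=> hx'; have := congr1 (fun B : 'rV_ _ => B ord0 (enum_rank_in hx' x')) hy.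
  rewrite !mxE => h; rewrite -[RHS]h.
  under [RHS]eq_bigr => a _ do rewrite mxE enum_rankK_in //.
  exact/esym/(@sum_extend0 _ _ _ _ _ _ _ rows (fun a => y ord0 a) C^o
    (fun x => (Mup_entry R blocks L x x')%:C)).
have g_out x : x \notin rows -> g x = 0 by apply: extend0_out.
have in_col x k : (k <= d)%N -> Msum R x = W k -> x \in cols.
  move=> hk hx; rewrite in_cols; apply/existsP.
  by exists (Ordinal (hk : (k < d.+1)%N)); rewrite /= hx.
have hsucc k : W k.+1 = W k + 1 :> R by rewrite -natr1; ring.
have hlow n : forall k x', (k < n)%N -> (k < d)%N -> Msum R x' = W k -> g x' = 0.
  elim: n => // n IH k x' hkn hk hx'; have := hcol x' (in_col _ _ (ltnW hk) hx').
  rewrite (bigD1 x') //= big1 ?addr0 => [|x xx'].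
    rewrite (Mup_entry_diag hk hx') => /eqP.
    by rewrite mulf_eq0 (negbTE (ladder_coef_neq0 R hk)) orbF => /eqP.
  have [/in_rows hx|hx] := boolP (x \in rows); last by rewrite g_out ?mul0r.
  case: hx => [[j hj hx]|hx]; last first.
    rewrite /Mup_entry spinrS spinrE hx eqxx hx'.
    by case: eqP => [/weight_inj e|_]; rewrite ?mulr0 //; move: hk; rewrite e ltnn.
  have [ejk|ejk] := eqVneq k j.+1.
    by rewrite (IH j) ?mul0r //; rewrite ejk in hkn.
  rewrite /Mup_entry spinrS hx hx' -hsucc (negbTE xx') mulr0.
  case: eqP => [/weight_inj e|_]; first by move: hj; rewrite e; lia.
  case: eqP => _; first by rewrite mulr0.
  case: eqP => [/weight_inj e|_]; last by rewrite mulr0.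
  by rewrite e eqxx in ejk.
have {}hlow k x' : (k < d)%N -> Msum R x' = W k -> g x' = 0.
  by move=> hk; apply: (hlow k.+1).
pose B (m : M) := if Msum R (cls m) == W d.+1 then g (cls m) else 0.
have hB : wt_supp (W d.+1) B.
  by move=> m hm; rewrite /B Msum_cls; case: eqP.
have hlB m : lower B m = 0.
  case: (pselect (wt R m = W d)) => hm; last first.
    by apply: (wt_supp_lower hB) => e; apply: hm; rewrite e hsucc addrK.
  have hx' : Msum R (cls m) = W d by rewrite Msum_cls.
  rewrite /B -(sum_down_entry hblocks (fun x => if Msum R x == W d.+1 then g x else 0)).
  rewrite -[RHS](hcol (cls m) (in_col _ _ (leqnn d) hx')); apply: eq_bigr => x _.
  have [/in_rows hx|hx] := boolP (x \in rows); last first.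
    by rewrite g_out //; case: ifP; rewrite !mul0r.
  case: hx => [[k hk hx]|hx].
    by rewrite (hlow k) //; case: ifP; rewrite !mul0r.
  by rewrite /Mup_entry spinrS spinrE hx hx' !eqxx.
have B0 m : B m = 0.
  apply: (positive_lowest_eq0 _ hB hlB).
  by rewrite -natr1; have : 0 <= d%:R :> R by []; lra.
apply/matrixP => i a; rewrite ord1 mxE -[LHS](@extend0_val _ _ _ _ _ _ _ rows (fun a => y ord0 a)).
rewrite -/(g _).
have /in_rows[[k hk hx]|hx] := enum_valP a; first exact: hlow hk hx.
by have := B0 (repr (enum_val a)); rewrite /B reprK hx eqxx.
Qed.

Lemma card_rows_cols :
  (#|rows| + #|MbarK ell l (spinr R L)| =
   #|cols| + #|MbarK ell l (spinr R L + 1)|)%N.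
Proof.
pose U := \bigcup_(K : Mell L | weight R K != spinr R L) MbarK ell l (weight R K).
have colsE : cols = U :|: MbarK ell l (spinr R L).
  rewrite /Mbar_le (bigID (fun K : Mell L => weight R K != spinr R L)) /=; congr (_ :|: _).
  rewrite (big_pred1 (ord_max : Mell L)) => [|K /=].
    by congr (MbarK _ _ _); rewrite /weight /spinr /=; field.
  rewrite negbK spinrE /weight (inj_eq (addIr _)) eqr_nat.
  by rewrite -(inj_eq val_inj).
have disj K0 : (forall K : Mell L, weight R K != spinr R L -> weight R K != K0) ->
    U :&: MbarK ell l K0 = finset.set0.
  move=> h; apply/finset.setP => x; rewrite !inE; apply/negP => /andP[/bigcupP[K hK]].
  by rewrite !inE => /eqP -> ; apply/negP/h.
rewrite colsE /Mbar_rows -/U !cardsU !disj ?cards0 ?subn0 //.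
  by rewrite addnAC.
move=> K; rewrite weight_top spinrS => hK.
by rewrite /weight (inj_eq (addIr _)) eqr_nat neq_ltn (leq_trans hK).
Qed.

Lemma dim_ker_row_free (K : fieldType) (p n : nat) (A : 'M[K]_(p, n)) : row_free A ->
  (\dim (lker (linfun (mulmx A : 'cV[K]_n -> 'cV[K]_p))) + p = n)%N.
Proof.
move=> hA; set f := linfun _.
have dimf q : \dim (fullv : {vspace 'cV[K]_q}) = q by rewrite dimvf /dim /= muln1.
have [B hB] := row_freeP hA.
have full : (f @: fullv)%VS = fullv.
  apply/eqP; rewrite eqEsubv subvf /=; apply/subvP => v _.
  have -> : v = f (B *m v) by rewrite lfunE /= mulmxA hB mul1mx.
  by apply: memv_img; apply: memvf.
by have := limg_ker_dim f fullv; rewrite capfv full !dimf.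
Qed.

Lemma dim_kerMup :
  (\dim (kerMup R ell l blocks L) + #|rows| = #|cols|)%N.
Proof. exact: dim_ker_row_free Mup_row_free. Qed.

End KernelBasis.

(** * The theorem *)

Theorem theorem3p19
  (R : realType) (G : rotation_group)
  (disp : Order.disp_t) (LI : orderType disp) (ell : LI -> spin G)
  (Omega : Type) (act : ambient R G -> Omega -> Omega) (hact : is_action act)
  (F : comAlgType R[i])
  (D : forall s : spin G, ambient R G -> 'M[R[i]]_((twice s).+1))
  (hD : is_wignerD D)
  (phi : forall l : LI, Mell (ell l) -> Omega -> F)
  (hphi : phi_equivariant phi act D)
  (H : set (Omega -> F)) (ip : (Omega -> F) -> (Omega -> F) -> R[i])
  (hip : scalar_product_on H ip)
  (hortho : phi_orthonormal phi H ip)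
  (N : nat) (hN : (0 < N)%N)
  (HN : set (('I_N -> Omega) -> F))
  (ipN : (('I_N -> Omega) -> F) -> (('I_N -> Omega) -> F) -> R[i])
  (hipN : tensor_scalar_product H ip HN ipN)
  (l : N.-tuple LI) (hl : sorted <=%O l)
  (blocks : seq (LI * nat)) (hblocks : minimal_partition l blocks)
  (L : spin G) :
  (forall c : (\dim (kerMup R ell l blocks L)).-tuple 'cV[R[i]]_(#|Mbar_le R ell l L|),
     basis_of (kerMup R ell l blocks L) c ->
     is_basis (VbarL l (L := L) phi act D)
       (fun i : 'I_(\dim (kerMup R ell l blocks L)) => bvec phi (tnth c i)))
  /\ has_dim (VbarL l (L := L) phi act D) (\dim (kerMup R ell l blocks L))
  /\ (\dim (kerMup R ell l blocks L))%:Z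
       = #|MbarK ell l (spinr R L)|%:Z - #|MbarK ell l (spinr R L + 1)|%:Z.
Proof.
have in_ker (c : 'cV[R[i]]_(#|Mbar_le R ell l L|)) :
    (c \in kerMup R ell l blocks L) = (Mup R ell l blocks L *m c == 0).
  by rewrite memv_ker lfunE.
have bvec_sum n (a : 'I_n -> R[i]) (c : 'I_n -> 'cV[R[i]]_(#|Mbar_le R ell l L|)) :
    \sum_i a i *: bvec phi (c i) = bvec phi (\sum_i a i *: c i).
  apply/funext => K; apply/funext => r; rewrite !fct_sumE.
  rewrite bvec_family /family combinationE.
  under [RHS]eq_bigr => m _ do rewrite fam_linear scaler_suml.
  rewrite exchange_big /=; apply: eq_bigr => i _.
  transitivity (a i *: bvec phi (c i) K r); first by [].
  rewrite bvec_family /family combinationE scaler_sumr.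
  by apply: eq_bigr => m _; rewrite scalerA.
have bvec_inj (c : 'cV[R[i]]_(#|Mbar_le R ell l L|)) : bvec phi c = 0 -> c = 0.
  rewrite bvec_family => c0; apply: fam_eq0 => k m hk.
  apply: (phibar_free hortho hipN hN (fam_invariant c k)).
  exact: (congr1 (fun f => f (Ordinal (hk : (k < (twice L).+1)%N))) c0).
have bvec_VbarL (c : 'cV[R[i]]_(#|Mbar_le R ell l L|)) :
    c \in kerMup R ell l blocks L -> VbarL l (L := L) phi act D (bvec phi c).
  rewrite in_ker => /eqP /(Mup_ker_string hblocks) /inf_intertwines_string.
  move=> /(intertwinesP hD) h; rewrite bvec_family.
  exact: intertwines_VbarL.
have VbarL_bvec f : VbarL l (L := L) phi act D f ->
    exists2 c, c \in kerMup R ell l blocks L & f = bvec phi c.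
  move=> hf; have [hV _] := hf.
  have hB (K : Mell L) : exists B : Mtuple ell l -> R[i],
      class_invariant B /\ f K = combination phi B.
    by have [B hB fB] := Vbar_class_invariant (hV K); exists B.
  have [B hBs] := choice hB.
  pose A k := B (inord k).
  have hA k : class_invariant (A k) by have [] := hBs (inord k).
  have fA : f = family phi (L := L) A.
    by apply/funext => K; have [_ ->] := hBs K; rewrite /family /A inord_val.
  rewrite fA in hf.
  have hstr : string_relations L A.
    apply/inf_intertwines_string/(intertwinesP hD).
    exact: (VbarL_intertwines hphi hortho hipN hN hA hf).
  have [hs _ _ _ _] := hstr.
  have [c hc] := string_fam hA hs.
  have fc : bvec phi c = f.
    rewrite bvec_family fA; apply/funext => K; rewrite /family; congr combination.
    by apply/funext => m; rewrite hc // -ltnS.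
  exists c => //; rewrite in_ker; apply/eqP/(Mup_ker_string hblocks).
  apply/inf_intertwines_string/(intertwinesP hD).
  apply: (VbarL_intertwines hphi hortho hipN hN (fam_invariant c)).
  by rewrite -bvec_family fc fA.
have main (c : (\dim (kerMup R ell l blocks L)).-tuple 'cV[R[i]]_(#|Mbar_le R ell l L|)) :
     basis_of (kerMup R ell l blocks L) c ->
     is_basis (VbarL l (L := L) phi act D)
       (fun i : 'I_(\dim (kerMup R ell l blocks L)) => bvec phi (tnth c i)).
  move=> hc; split; last first.
    move=> a; rewrite bvec_sum => /bvec_inj a0 i.
    have /freeP fr := basis_free hc.
    apply: fr; rewrite -[RHS]a0; apply: eq_bigr => j _.
    by rewrite (tnth_nth 0).
  apply/seteqP; split=> f.
    case/VbarL_bvec => c0 hc0 ->; exists (fun i => coord c i c0).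
    rewrite bvec_sum {1}(coord_basis hc hc0); congr bvec.
    by apply: eq_bigr => i _; rewrite (tnth_nth 0).
  case=> a ->; rewrite bvec_sum; apply: bvec_VbarL.
  by apply: rpred_sum => i _; apply: rpredZ; apply: (basis_mem hc); apply: mem_tnth.
split; first exact: main.
split; first by exists (fun i => bvec phi (tnth (vbasis _) i)); apply: main; apply: vbasisP.
have hker := @dim_kerMup R G disp LI ell N l blocks hblocks L.
have hcard := card_rows_cols R ell l L.
lia.
Qed.
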